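(* There exist linear operators $\mathcal{D},\mathcal{L}:\mathbb{C}[u,\mathbf{v}]\to\mathbb{C}[u,\mathbf{v}]$ such that, setting $\mathcal{D}_N=\mathcal{D}-\frac{1}{N^2}\mathcal{L}$, we have $\Delta_N(p_N)=(\mathcal{D}_Np)_N$ for all $N\ge1$ and all $p\in\mathbb{C}[u,\mathbf{v}]$. Moreover $\mathcal{D}$ is the unique linear operator on $\mathbb{C}[u,\mathbf{v}]$ satisfying: (1) $\mathcal{D}(u^k)=-ku^k-2\sum_{m=1}^{k-1}mu^mv_{k-m}$ for all $k\ge1$; (2) $\mathcal{D}(v_k)=-kv_k-2\sum_{m=1}^{k-1}mv_mv_{k-m}$ for all $k\ge1$; (3) $\mathcal{D}(pq)=\mathcal{D}(p)q+p\mathcal{D}(q)$ for all $p,q\in\mathbb{C}[u,\mathbf{v}]$ such that $p$ or $q$ is scalar.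
   Context: $\mathbb{C}[u,\mathbf{v}]$ is the polynomial algebra over $\mathbb{C}$ in one indeterminate $u$ and infinitely many indeterminates $\mathbf{v}=(v_1,v_2,\dots)$ (each element involves finitely many of them); $p$ is scalar if it does not depend on $u$. For $p\in\mathbb{C}[u,\mathbf{v}]$ and $N\ge1$, $p_N:U(N)\to M_N(\mathbb{C})$ is $p_N(U)=p(U,\mathrm{tr}(U),\mathrm{tr}(U^2),\dots)$, i.e. substitute $u=U$, $v_j=\mathrm{tr}(U^j)I$, where $\mathrm{tr}=\frac1N\mathrm{Trace}$. $\Delta_N=\sum_j\tilde X_j^2$ for an orthonormal basis of $u(N)$ with respect to $\langle X,Y\rangle_N=N\,\mathrm{Re}\,\mathrm{Trace}(X^*Y)$, $(\tilde Xf)(U)=\frac{d}{ds}f(Ue^{sX})|_{s=0}$, acting entrywise. *)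

(* Defs.v *)
From Stdlib Require Import Reals List Arith ClassicalEpsilon.
Import ListNotations.
Open Scope R_scope.

Definition C := (R * R)%type.
Definition C0 : C := (0, 0).
Definition C1 : C := (1, 0).
Definition RtoC (r : R) : C := (r, 0).
Definition Cadd (a b : C) : C := (fst a + fst b, snd a + snd b).
Definition Cmul (a b : C) : C :=
  (fst a * fst b - snd a * snd b, fst a * snd b + snd a * fst b).
Definition Copp (a : C) : C := (- fst a, - snd a).
Definition Cconj (a : C) : C := (fst a, - snd a).
Definition Csum (l : list C) : C := fold_right Cadd C0 l.
Fixpoint Cpow (a : C) (n : nat) : C :=
  match n with O => C1 | S n => Cmul a (Cpow a n) end.

(* ---------- N x N complex matrices (only indices < N matter) ---------- *)
Definition Mat := nat -> nat -> C.
Definition mzero : Mat := fun _ _ => C0.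
Definition mid : Mat := fun i j => if Nat.eqb i j then C1 else C0.
Definition mmul (N : nat) (A B : Mat) : Mat :=
  fun i j => Csum (map (fun k => Cmul (A i k) (B k j)) (seq 0 N)).
Definition madd (A B : Mat) : Mat := fun i j => Cadd (A i j) (B i j).
Definition mscale (c : C) (A : Mat) : Mat := fun i j => Cmul c (A i j).
Definition madj (A : Mat) : Mat := fun i j => Cconj (A j i).
Fixpoint mpow (N : nat) (A : Mat) (k : nat) : Mat :=
  match k with O => mid | S k => mmul N A (mpow N A k) end.
Definition mtrace (N : nat) (A : Mat) : C := Csum (map (fun i => A i i) (seq 0 N)).
Definition ntr (N : nat) (A : Mat) : C := Cmul (RtoC (/ INR N)) (mtrace N A).

Definition unitary (N : nat) (U : Mat) : Prop :=
  forall i j, (i < N)%nat -> (j < N)%nat ->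
    mmul N (madj U) U i j = mid i j /\ mmul N U (madj U) i j = mid i j.

Fixpoint exp_partial (N : nat) (X : Mat) (n : nat) : Mat :=
  match n with
  | O => mid
  | S n' => madd (exp_partial N X n') (mscale (RtoC (/ INR (fact n))) (mpow N X n))
  end.
Definition is_expm (N : nat) (X E : Mat) : Prop :=
  forall i j, (i < N)%nat -> (j < N)%nat ->
    Un_cv (fun n => fst (exp_partial N X n i j)) (fst (E i j)) /\
    Un_cv (fun n => snd (exp_partial N X n i j)) (snd (E i j)).
Definition expm (N : nat) (X : Mat) : Mat :=
  epsilon (inhabits mzero) (is_expm N X).

Definition skew_hermitian (N : nat) (X : Mat) : Prop :=
  forall i j, (i < N)%nat -> (j < N)%nat -> X i j = Copp (Cconj (X j i)).
Definition inner (N : nat) (X Y : Mat) : R :=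
  INR N * fst (mtrace N (mmul N (madj X) Y)).
(* an orthonormal basis of u(N) (real dimension N^2) *)
Definition onb_uN (N : nat) (B : list Mat) : Prop :=
  length B = (N * N)%nat /\ Forall (skew_hermitian N) B /\
  forall a b, (a < N * N)%nat -> (b < N * N)%nat ->
    inner N (nth a B mzero) (nth b B mzero) = (if Nat.eqb a b then 1 else 0).

Definition rderiv (g : R -> R) (s : R) : R :=
  epsilon (inhabits 0) (fun l => derivable_pt_lim g s l).
Definition Xtilde (N : nat) (X : Mat) (f : Mat -> C) : Mat -> C :=
  fun U =>
    (rderiv (fun s => fst (f (mmul N U (expm N (mscale (RtoC s) X))))) 0,
     rderiv (fun s => snd (f (mmul N U (expm N (mscale (RtoC s) X))))) 0).
Definition Laplacian (N : nat) (B : list Mat) (F : Mat -> Mat) : Mat -> Mat :=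
  fun U i j => Csum (map (fun X => Xtilde N X (Xtilde N X (fun V => F V i j)) U) B).

(* An exponent list e encodes the monomial u^(e_0) v_1^(e_1) v_2^(e_2) ...
   (entries beyond the length are 0). A polynomial is a finite formal sum of
   terms; two polynomials are equal (peq) iff all their coefficients agree. *)
Definition expo := list nat.
Definition term := (C * expo)%type.
Definition cpoly := list term.

Fixpoint strip (e : expo) : expo :=
  match e with
  | [] => []
  | x :: l => match strip l with
              | [] => if Nat.eqb x 0 then [] else [x]
              | l' => x :: l'
              end
  end.
Definition expo_eqb (a b : expo) : bool :=
  if list_eq_dec Nat.eq_dec (strip a) (strip b) then true else false.
Definition coef (p : cpoly) (m : expo) : C :=
  Csum (map fst (filter (fun t => expo_eqb (snd t) m) p)).
Definition peq (p q : cpoly) : Prop := forall m, coef p m = coef q m.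

Fixpoint eadd (a b : expo) : expo :=
  match a, b with
  | [], b => b
  | a, [] => a
  | x :: a', y :: b' => (x + y)%nat :: eadd a' b'
  end.
Definition padd (p q : cpoly) : cpoly := p ++ q.
Definition pscale (c : C) (p : cpoly) : cpoly := map (fun t => (Cmul c (fst t), snd t)) p.
Definition pmul (p q : cpoly) : cpoly :=
  flat_map (fun t1 => map (fun t2 => (Cmul (fst t1) (fst t2), eadd (snd t1) (snd t2))) q) p.
Definition psum (l : list cpoly) : cpoly := concat l.
Definition pu (k : nat) : cpoly := [(C1, [k])].
Definition pv (k : nat) : cpoly := [(C1, repeat 0%nat k ++ [1%nat])].
Definition scalar (p : cpoly) : Prop :=
  forall m, nth 0 m 0%nat <> 0%nat -> coef p m = C0.

(* p_N(U) = p(U, tr(U), tr(U^2), ...) *)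
Definition tprod (N : nat) (U : Mat) (e : expo) : C :=
  fold_right Cmul C1
    (map (fun j => Cpow (ntr N (mpow N U j)) (nth j e 0%nat)) (seq 1 (length e - 1))).
Definition peval (N : nat) (p : cpoly) (U : Mat) : Mat :=
  fun i k => Csum (map (fun t =>
    Cmul (Cmul (fst t) (tprod N U (snd t))) (mpow N U (nth 0 (snd t) 0%nat) i k)) p).

Definition plinear (D : cpoly -> cpoly) : Prop :=
  (forall p q, peq p q -> peq (D p) (D q)) /\
  (forall p q, peq (D (padd p q)) (padd (D p) (D q))) /\
  (forall c p, peq (D (pscale c p)) (pscale c (D p))).

Definition DN (N : nat) (D L : cpoly -> cpoly) (p : cpoly) : cpoly :=
  padd (D p) (pscale (RtoC (- / (INR N * INR N))) (L p)).

Definition D_props (D : cpoly -> cpoly) : Prop :=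
  (forall k, (1 <= k)%nat ->
     peq (D (pu k))
       (padd (pscale (RtoC (- INR k)) (pu k))
          (pscale (RtoC (-2))
             (psum (map (fun m => pscale (RtoC (INR m)) (pmul (pu m) (pv (k - m))))
                        (seq 1 (k - 1))))))) /\
  (forall k, (1 <= k)%nat ->
     peq (D (pv k))
       (padd (pscale (RtoC (- INR k)) (pv k))
          (pscale (RtoC (-2))
             (psum (map (fun m => pscale (RtoC (INR m)) (pmul (pv m) (pv (k - m))))
                        (seq 1 (k - 1))))))) /\
  (forall p q, scalar p \/ scalar q ->
     peq (D (pmul p q)) (padd (pmul (D p) q) (pmul p (D q)))).

(* Main.v *)
From Stdlib Require Import Reals List Arith Lia Lra RList Permutation Morphisms.
From Stdlib Require Import ClassicalEpsilon FunctionalExtensionality.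
From Coquelicot Require Import Rbar Lim_seq Hierarchy Derive PSeries.
From Coquelicot Require Complex.
Require Import Defs.
Import ListNotations.
Open Scope R_scope.

(** Over an orthonormal basis of u(N) one has [sum_X X_ij X_kl = - (1/N) delta_il delta_jk],
    hence [sum_X X M X = - tr(M) I] and [sum_X tr(X M) X = - (1/N^2) M].  The operators X~ are
    derivations, so [Delta (F G) = (Delta F) G + 2 Gamma(F, G) + F (Delta G)] with
    [Gamma(F, G) = sum_X (X~ F) (X~ G)].  Applied to [U * U^k], the first identity computes
    [Delta U^k] and, taking traces, [Delta tr(U^k)]: this is D.  By the second identity
    [Gamma(tr U^j, U^k) = - (jk/N^2) U^(j+k)], so peeling the factors [v_j] off a monomial
    produces, besides D, only terms of order [1/N^2], which make up L. *)

Declare Scope cplx_scope.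
Delimit Scope cplx_scope with c.
Local Arguments Cadd (a b)%_c.
Local Arguments Cmul (a b)%_c.
Local Arguments Copp a%_c.
Local Arguments Cconj a%_c.
Local Arguments RtoC r%_R.
Local Infix "+" := Cadd : cplx_scope.
Local Infix "*" := Cmul : cplx_scope.
Local Notation "- a" := (Copp a) : cplx_scope.
Local Notation "\sum_ ( x 'in' l ) e" := (Csum (map (fun x => e) l))
  (at level 41, x name, l at level 200, e at level 41) : cplx_scope.
Local Notation "\sum_ ( i < n ) e" := (Csum (map (fun i => e) (seq 0 n)))
  (at level 41, i name, n at level 60, e at level 41) : cplx_scope.

Lemma C_ext (a b : C) : fst a = fst b -> snd a = snd b -> a = b.
Proof. destruct a, b; simpl; intros; subst; reflexivity. Qed.

Lemma C_ring_theory :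
  ring_theory C0 C1 Cadd Cmul (fun a b => Cadd a (Copp b)) Copp eq.
Proof. constructor; intros; apply C_ext; simpl; ring. Qed.

Add Ring C_ring : C_ring_theory.

Lemma RtoC_add x y : RtoC (x + y) = (RtoC x + RtoC y)%c.
Proof. apply C_ext; simpl; ring. Qed.

Lemma RtoC_mul x y : RtoC (x * y) = (RtoC x * RtoC y)%c.
Proof. apply C_ext; simpl; ring. Qed.

Lemma RtoC_opp x : RtoC (- x) = (- RtoC x)%c.
Proof. apply C_ext; simpl; ring. Qed.

Lemma RtoC_S n : RtoC (INR (S n)) = (C1 + RtoC (INR n))%c.
Proof. rewrite S_INR, RtoC_add; unfold C1, RtoC; apply C_ext; simpl; ring. Qed.

Lemma Cconj_add a b : Cconj (a + b) = (Cconj a + Cconj b)%c.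
Proof. apply C_ext; simpl; ring. Qed.

Lemma Cconj_mul a b : Cconj (a * b) = (Cconj a * Cconj b)%c.
Proof. apply C_ext; simpl; ring. Qed.

Lemma Cconj_invol a : Cconj (Cconj a) = a.
Proof. apply C_ext; simpl; ring. Qed.

(** * Finite sums *)

Local Open Scope cplx_scope.

Section FiniteSums.
Context {S T : Type}.
Implicit Types (f g : T -> C) (l : list T).

Lemma Csum_ext f g l :
  (forall x, In x l -> f x = g x) -> \sum_(x in l) f x = \sum_(x in l) g x.
Proof.
  intros H; induction l as [|x l IH]; simpl; [reflexivity|].
  f_equal; [apply H; left; reflexivity|].
  apply IH; intros y Hy; apply H; right; exact Hy.
Qed.

Lemma Csum_eq0 f l : (forall x, In x l -> f x = C0) -> \sum_(x in l) f x = C0.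
Proof.
  intros H; induction l as [|x l IH]; simpl; [reflexivity|].
  rewrite H, IH by (try intros y Hy; try apply H; simpl; tauto); ring.
Qed.

Lemma Csum_app f l l' :
  \sum_(x in l ++ l') f x = \sum_(x in l) f x + \sum_(x in l') f x.
Proof. induction l as [|x l IH]; simpl; [ring|rewrite IH; ring]. Qed.

Lemma Csum_add f g l :
  \sum_(x in l) (f x + g x) = \sum_(x in l) f x + \sum_(x in l) g x.
Proof. induction l as [|x l IH]; simpl; [ring|rewrite IH; ring]. Qed.

Lemma Csum_mul_l c f l : \sum_(x in l) c * f x = c * \sum_(x in l) f x.
Proof. induction l as [|x l IH]; simpl; [ring|rewrite IH; ring]. Qed.

Lemma Csum_mul_r c f l : \sum_(x in l) f x * c = (\sum_(x in l) f x) * c.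
Proof. induction l as [|x l IH]; simpl; [ring|rewrite IH; ring]. Qed.

Lemma Csum_exchange (f : S -> T -> C) (k : list S) l :
  \sum_(y in k) \sum_(x in l) f y x = \sum_(x in l) \sum_(y in k) f y x.
Proof.
  induction k as [|y k IH]; simpl; [symmetry; apply Csum_eq0; reflexivity|].
  rewrite IH, <- Csum_add; reflexivity.
Qed.

Lemma Csum_const c l : \sum_(x in l) c = RtoC (INR (length l)) * c.
Proof.
  induction l as [|x l IH]; [apply C_ext; simpl; ring|].
  cbn [length]; rewrite RtoC_S; simpl; rewrite IH; ring.
Qed.

Lemma Csum_flat_map (g : S -> list T) f (k : list S) :
  \sum_(x in flat_map g k) f x = \sum_(y in k) \sum_(x in g y) f x.
Proof.
  induction k as [|y k IH]; simpl; [reflexivity|].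
  rewrite Csum_app, IH; reflexivity.
Qed.

Lemma Cconj_sum f l : Cconj (\sum_(x in l) f x) = \sum_(x in l) Cconj (f x).
Proof.
  induction l as [|x l IH]; simpl; [apply C_ext; simpl; ring|].
  rewrite Cconj_add, IH; reflexivity.
Qed.

Lemma Csum_indicator (b : T -> bool) f l x :
  NoDup l -> In x l -> (forall y, In y l -> b y = true <-> y = x) ->
  \sum_(y in l) (if b y then C1 else C0) * f y = f x.
Proof.
  intros Hl Hx Hb; destruct (in_split x l Hx) as [l1 [l2 ->]].
  assert (Hrest : forall y, In y (l1 ++ l2) -> (if b y then C1 else C0) * f y = C0).
  { intros y Hy; destruct (b y) eqn:E; [|ring].
    apply Hb in E; [subst y; destruct (NoDup_remove_2 _ _ _ Hl Hy)|].
    apply in_app_iff in Hy; apply in_app_iff; simpl; tauto. }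
  rewrite Csum_app; simpl; rewrite (proj2 (Hb x Hx) eq_refl).
  rewrite !Csum_eq0 by (intros y Hy; apply Hrest, in_app_iff; tauto); ring.
Qed.

Lemma Csum_fst_nonneg f l :
  (forall x, In x l -> 0 <= fst (f x)) -> 0 <= fst (\sum_(x in l) f x).
Proof.
  intros H; induction l as [|x l IH]; simpl; [lra|].
  pose proof (H x (or_introl eq_refl)).
  specialize (IH (fun y Hy => H y (or_intror Hy))); lra.
Qed.

Lemma Csum_fst_nonneg_eq0 f l :
  (forall x, In x l -> 0 <= fst (f x)) -> fst (\sum_(x in l) f x) = 0%R ->
  forall x, In x l -> fst (f x) = 0%R.
Proof.
  intros Hpos Hsum x Hx; destruct (in_split x l Hx) as [l1 [l2 ->]].
  rewrite Csum_app in Hsum; simpl in Hsum.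
  assert (Hpart : forall k, incl k (l1 ++ x :: l2) -> 0 <= fst (\sum_(y in k) f y)).
  { intros k Hk; apply Csum_fst_nonneg; intros y Hy; apply Hpos, Hk, Hy. }
  pose proof (Hpart l1 (incl_appl _ (incl_refl l1))).
  pose proof (Hpart l2 (incl_appr _ (incl_tl x (incl_refl l2)))).
  pose proof (Hpos x Hx); lra.
Qed.

End FiniteSums.

Lemma Csum_ext_lt (f g : nat -> C) n :
  (forall i, (i < n)%nat -> f i = g i) -> \sum_(i < n) f i = \sum_(i < n) g i.
Proof. intros H; apply Csum_ext; intros i Hi; apply in_seq in Hi; apply H; lia. Qed.

Lemma Csum_seq_S (f : nat -> C) n : \sum_(k < S n) f k = \sum_(k < n) f k + f n.
Proof. rewrite seq_S, Csum_app; simpl; ring. Qed.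

Lemma Csum_seq_S_l (f : nat -> C) n : \sum_(k < S n) f k = f 0%nat + \sum_(k < n) f (S k).
Proof. simpl; rewrite <- seq_shift, map_map; reflexivity. Qed.

Lemma Csum_seq_from_1 (f : nat -> C) n : f 0%nat = C0 ->
  \sum_(m in seq 1 (n - 1)) f m = \sum_(m < n) f m.
Proof.
  intros H; destruct n as [|n]; [reflexivity|].
  simpl; rewrite H, Nat.sub_0_r; ring.
Qed.

Lemma Csum_seq_offset (f : nat -> C) s n :
  \sum_(p in seq s n) f p = \sum_(i < n) f (s + i)%nat.
Proof.
  induction n as [|n IH]; [reflexivity|].
  rewrite seq_S, Csum_app, IH, Csum_seq_S; simpl; ring.
Qed.

Lemma Csum_divmod (f : nat -> nat -> C) m n :
  \sum_(p < m * n) f (p / n)%nat (p mod n)%nat = \sum_(i < m) \sum_(j < n) f i j.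
Proof.
  induction m as [|m IH]; [reflexivity|].
  replace (S m * n)%nat with (m * n + n)%nat by lia.
  rewrite seq_app, Csum_app, IH, Csum_seq_S, (Csum_seq_offset _ (0 + m * n)); f_equal.
  apply Csum_ext_lt; intros j Hj; f_equal.
  - symmetry; apply Nat.div_unique with j; lia.
  - symmetry; apply Nat.mod_unique with m; lia.
Qed.

Lemma Csum_nth {T} (f : T -> C) (l : list T) d :
  \sum_(x in l) f x = \sum_(a < length l) f (nth a l d).
Proof.
  induction l as [|x l IH]; [reflexivity|].
  cbn [length]; rewrite Csum_seq_S_l; simpl; rewrite IH; reflexivity.
Qed.

(** * Matrices *)

Definition meq (N : nat) (A B : Mat) : Prop :=
  forall i j, (i < N)%nat -> (j < N)%nat -> A i j = B i j.

Definition msum {T} (F : T -> Mat) (l : list T) : Mat :=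
  fun i j => \sum_(x in l) F x i j.

Definition vtr (N : nat) (U : Mat) (k : nat) : C := ntr N (mpow N U k).

Declare Scope mat_scope.
Delimit Scope mat_scope with M.
Local Arguments mmul N%_nat (A B)%_M _ _.
Local Arguments meq N%_nat (A B)%_M.
Local Arguments madd (A B)%_M _ _.
Local Arguments mscale c%_c A%_M _ _.
Local Arguments madj A%_M _ _.
Local Arguments ntr N%_nat A%_M.
Local Arguments mtrace N%_nat A%_M.
Local Notation "A =[ N ] B" := (meq N A B) (at level 70, N at level 200).
Local Notation "A *[ N ] B" := (mmul N A B) (at level 40, N at level 200, left associativity).
Local Infix "+" := madd : mat_scope.
Local Infix "*:" := mscale (at level 40) : mat_scope.

Section MatrixAlgebra.
Variable N : nat.
Implicit Types A B : Mat.

Global Instance meq_equivalence : Equivalence (meq N).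
Proof.
  split.
  - intros A i j _ _; reflexivity.
  - intros A B H i j Hi Hj; symmetry; apply H; assumption.
  - intros A B D H H' i j Hi Hj; rewrite H, H' by assumption; reflexivity.
Qed.

Global Instance mmul_proper : Proper (meq N ==> meq N ==> meq N) (mmul N).
Proof.
  intros A A' HA B B' HB i j Hi Hj; apply Csum_ext_lt; intros k Hk.
  rewrite HA, HB by assumption; reflexivity.
Qed.

Global Instance madd_proper : Proper (meq N ==> meq N ==> meq N) madd.
Proof.
  intros A A' HA B B' HB i j Hi Hj; unfold madd.
  rewrite HA, HB by assumption; reflexivity.
Qed.

Global Instance mscale_proper : Proper (eq ==> meq N ==> meq N) mscale.
Proof.
  intros c c' <- A A' HA i j Hi Hj; unfold mscale; rewrite HA by assumption; reflexivity.
Qed.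

Global Instance mtrace_proper : Proper (meq N ==> eq) (mtrace N).
Proof. intros A A' HA; apply Csum_ext_lt; intros i Hi; apply HA; exact Hi. Qed.

Global Instance ntr_proper : Proper (meq N ==> eq) (ntr N).
Proof. intros A A' HA; unfold ntr; rewrite HA; reflexivity. Qed.

Lemma msum_ext {T} (F G : T -> Mat) l :
  (forall x, In x l -> F x =[N] G x) -> msum F l =[N] msum G l.
Proof. intros H i j Hi Hj; apply Csum_ext; intros x Hx; apply H; assumption. Qed.

Lemma mmul_assoc A1 A2 A3 : A1 *[N] (A2 *[N] A3) =[N] A1 *[N] A2 *[N] A3.
Proof.
  intros i j _ _; unfold mmul.
  transitivity (\sum_(k < N) \sum_(m < N) A1 i k * A2 k m * A3 m j).
  - apply Csum_ext; intros k _; rewrite <- Csum_mul_l; apply Csum_ext; intros; ring.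
  - rewrite Csum_exchange; apply Csum_ext; intros m _; apply Csum_mul_r.
Qed.

Lemma mid_sym i j : mid i j = mid j i.
Proof. unfold mid; rewrite Nat.eqb_sym; reflexivity. Qed.

Lemma Csum_mid (f : nat -> C) i : (i < N)%nat -> \sum_(k < N) mid i k * f k = f i.
Proof.
  intros Hi; apply (Csum_indicator (fun k => Nat.eqb i k)).
  - apply seq_NoDup.
  - apply in_seq; lia.
  - intros k _; rewrite Nat.eqb_eq; split; congruence.
Qed.

Lemma mmul_mid_l A : mid *[N] A =[N] A.
Proof. intros i j Hi _; apply (Csum_mid (fun k => A k j) i Hi). Qed.

Lemma mmul_mid_r A : A *[N] mid =[N] A.
Proof.
  intros i j _ Hj; rewrite <- (Csum_mid (fun k => A i k) j Hj).
  apply Csum_ext; intros k _; rewrite (mid_sym k j); ring.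
Qed.

Lemma mmul_madd_l A1 A2 B : (A1 + A2) *[N] B =[N] A1 *[N] B + A2 *[N] B.
Proof.
  intros i j _ _; unfold mmul, madd; rewrite <- Csum_add; apply Csum_ext; intros; ring.
Qed.

Lemma mmul_madd_r A B1 B2 : A *[N] (B1 + B2) =[N] A *[N] B1 + A *[N] B2.
Proof.
  intros i j _ _; unfold mmul, madd; rewrite <- Csum_add; apply Csum_ext; intros; ring.
Qed.

Lemma mmul_mscale_l c A B : (c *: A)%M *[N] B =[N] (c *: (A *[N] B))%M.
Proof.
  intros i j _ _; unfold mmul, mscale; rewrite <- Csum_mul_l; apply Csum_ext; intros; ring.
Qed.

Lemma mmul_mscale_r c A B : A *[N] (c *: B) =[N] c *: (A *[N] B).
Proof.
  intros i j _ _; unfold mmul, mscale; rewrite <- Csum_mul_l; apply Csum_ext; intros; ring.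
Qed.

Lemma mscale_mscale c d A : c *: (d *: A) =[N] c * d *: A.
Proof. intros i j _ _; unfold mscale; ring. Qed.

Lemma mmul_msum_l {T} A (F : T -> Mat) l :
  A *[N] msum F l =[N] msum (fun x => A *[N] F x) l.
Proof.
  intros i j _ _; unfold mmul, msum; rewrite Csum_exchange; apply Csum_ext; intros k _.
  symmetry; apply Csum_mul_l.
Qed.

Lemma mmul_msum_r {T} A (F : T -> Mat) l :
  msum F l *[N] A =[N] msum (fun x => F x *[N] A) l.
Proof.
  intros i j _ _; unfold mmul, msum; rewrite Csum_exchange; apply Csum_ext; intros k _.
  symmetry; apply Csum_mul_r.
Qed.

Lemma mscale_msum {T} c (F : T -> Mat) l :
  c *: msum F l =[N] msum (fun x => c *: F x)%M l.
Proof. intros i j _ _; unfold mscale, msum; symmetry; apply Csum_mul_l. Qed.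

Lemma msum_madd {T} (F G : T -> Mat) l :
  msum (fun x => F x + G x)%M l =[N] msum F l + msum G l.
Proof. intros i j _ _; apply Csum_add. Qed.

Lemma msum_exchange {S T} (F : S -> T -> Mat) k l :
  msum (fun y => msum (F y) l) k =[N] msum (fun x => msum (fun y => F y x) k) l.
Proof. intros i j _ _; apply Csum_exchange. Qed.

Lemma msum_seq_S (F : nat -> Mat) n :
  msum F (seq 0 (S n)) =[N] msum F (seq 0 n) + F n.
Proof. intros i j _ _; apply (Csum_seq_S (fun m => F m i j)). Qed.

Lemma msum_seq_S_l (F : nat -> Mat) n :
  msum F (seq 0 (S n)) =[N] F 0%nat + msum (fun m => F (S m)) (seq 0 n).
Proof. intros i j _ _; apply (Csum_seq_S_l (fun m => F m i j)). Qed.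

Lemma msum_const {T} A (l : list T) : msum (fun _ => A) l =[N] RtoC (INR (length l)) *: A.
Proof. intros i j _ _; apply (Csum_const (A i j) l). Qed.

Lemma mpow_add U k l : mpow N U k *[N] mpow N U l =[N] mpow N U (k + l).
Proof.
  induction k as [|k IH]; simpl; [apply mmul_mid_l|].
  rewrite <- mmul_assoc, IH; reflexivity.
Qed.

Lemma mpow_1 U : mpow N U 1 =[N] U.
Proof. apply mmul_mid_r. Qed.

Lemma madj_mmul A B : madj (A *[N] B) =[N] madj B *[N] madj A.
Proof.
  intros i j _ _; unfold madj, mmul; rewrite Cconj_sum; apply Csum_ext; intros k _.
  rewrite Cconj_mul; ring.
Qed.

Lemma madj_invol A : madj (madj A) =[N] A.
Proof. intros i j _ _; apply Cconj_invol. Qed.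

Lemma mtrace_mmul_comm A B : mtrace N (A *[N] B) = mtrace N (B *[N] A).
Proof.
  unfold mtrace, mmul; rewrite Csum_exchange.
  apply Csum_ext; intros; apply Csum_ext; intros; ring.
Qed.

Lemma mtrace_madd A B : mtrace N (A + B) = mtrace N A + mtrace N B.
Proof. apply Csum_add. Qed.

Lemma mtrace_mscale c A : mtrace N (c *: A) = c * mtrace N A.
Proof. apply Csum_mul_l. Qed.

Lemma mtrace_mid : mtrace N mid = RtoC (INR N).
Proof.
  unfold mtrace; rewrite (Csum_ext _ (fun _ => C1)).
  - rewrite Csum_const, length_seq; ring.
  - intros i _; unfold mid; rewrite Nat.eqb_refl; reflexivity.
Qed.

Lemma ntr_mmul_comm A B : ntr N (A *[N] B) = ntr N (B *[N] A).
Proof. unfold ntr; rewrite mtrace_mmul_comm; reflexivity. Qed.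

Lemma ntr_madd A B : ntr N (A + B) = ntr N A + ntr N B.
Proof. unfold ntr; rewrite mtrace_madd; ring. Qed.

Lemma ntr_mscale c A : ntr N (c *: A) = c * ntr N A.
Proof. unfold ntr; rewrite mtrace_mscale; ring. Qed.

Lemma ntr_msum {T} (F : T -> Mat) l : ntr N (msum F l) = \sum_(x in l) ntr N (F x).
Proof. unfold ntr, mtrace; rewrite Csum_mul_l; f_equal; apply Csum_exchange. Qed.

Lemma ntr_mid : (1 <= N)%nat -> ntr N mid = C1.
Proof.
  intros HN; unfold ntr; rewrite mtrace_mid; apply C_ext; simpl; [field|ring].
  apply not_0_INR; lia.
Qed.

Lemma mtrace_adj_mul_eq0 A : mtrace N (madj A *[N] A) = C0 -> A =[N] mzero.
Proof.
  intros H k i Hk Hi.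
  assert (Hsq : forall a, fst (Cconj a * a) = (fst a * fst a + snd a * snd a)%R)
    by (intros a; simpl; ring).
  assert (Hpos : forall a, 0 <= fst (Cconj a * a)) by (intros a; rewrite Hsq; nra).
  assert (Hcol : fst (\sum_(k < N) Cconj (A k i) * A k i) = 0%R).
  { apply (Csum_fst_nonneg_eq0 (fun i => \sum_(k < N) Cconj (A k i) * A k i) (seq 0 N)).
    - intros j _; apply Csum_fst_nonneg; intros l _; apply Hpos.
    - change (fst (mtrace N (madj A *[N] A)) = 0%R); rewrite H; reflexivity.
    - apply in_seq; lia. }
  assert (Hentry : fst (Cconj (A k i) * A k i) = 0%R).
  { apply (Csum_fst_nonneg_eq0 (fun k => Cconj (A k i) * A k i) (seq 0 N));
      [intros l _; apply Hpos|exact Hcol|apply in_seq; lia]. }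
  rewrite Hsq in Hentry; apply Rplus_sqr_eq_0 in Hentry as [? ?].
  apply C_ext; assumption.
Qed.

(* [Q = I - A A^*] satisfies [Q^* = Q = Q Q], so [Tr (Q^* Q) = Tr Q = N - Tr (A^* A) = 0]. *)
Lemma isometry_coisometry A :
  madj A *[N] A =[N] mid -> A *[N] madj A =[N] mid.
Proof.
  intros HA; set (P := A *[N] madj A); set (Q := (mid + - C1 *: P)%M).
  assert (HPP : P *[N] P =[N] P).
  { unfold P; rewrite mmul_assoc, <- (mmul_assoc A), HA, mmul_mid_r; reflexivity. }
  assert (HQadj : madj Q =[N] Q).
  { assert (HP : madj P =[N] P)
      by (unfold P; rewrite madj_mmul, madj_invol; reflexivity).
    intros i j Hi Hj; specialize (HP i j Hi Hj); unfold Q, madj, madd, mscale in *.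
    rewrite Cconj_add, Cconj_mul, HP; unfold mid; rewrite (Nat.eqb_sym j i).
    destruct (Nat.eqb i j); apply C_ext; simpl; ring. }
  assert (HQQ : Q *[N] Q =[N] Q).
  { unfold Q; rewrite mmul_madd_l, mmul_mid_l, mmul_mscale_l, mmul_madd_r, mmul_mid_r,
      mmul_mscale_r, HPP.
    intros i j _ _; unfold madd, mscale; ring. }
  assert (HQ : Q =[N] mzero).
  { apply mtrace_adj_mul_eq0; rewrite HQadj, HQQ; unfold Q, P.
    rewrite mtrace_madd, mtrace_mscale, mtrace_mmul_comm, HA, mtrace_mid; ring. }
  intros i j Hi Hj; specialize (HQ i j Hi Hj); unfold Q, madd, mscale, mzero in HQ.
  transitivity (P i j + (mid i j + - C1 * P i j)); [rewrite HQ|]; ring.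
Qed.

End MatrixAlgebra.

(** * Sums over an orthonormal basis *)

Section OrthonormalBasis.
Variables (N : nat) (B : list Mat).
Hypotheses (HN : (1 <= N)%nat) (HB : onb_uN N B).

Lemma onb_skew a : (a < N * N)%nat -> skew_hermitian N (nth a B mzero).
Proof.
  intros Ha; destruct HB as [Hlen [Hskew _]].
  rewrite Forall_forall in Hskew; apply Hskew, nth_In; rewrite Hlen; exact Ha.
Qed.

Lemma skew_mtrace_real X Y : skew_hermitian N X -> skew_hermitian N Y ->
  snd (mtrace N (madj X *[N] Y)) = 0%R.
Proof.
  intros HX HY; set (t := mtrace N (madj X *[N] Y)).
  assert (Ht : Cconj t = t).
  { unfold t, mtrace, mmul; rewrite Cconj_sum.
    rewrite (Csum_ext _ (fun i => \sum_(k < N) Cconj (madj X i k * Y k i)))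
      by (intros; apply Cconj_sum).
    rewrite Csum_exchange; apply Csum_ext_lt; intros i Hi; apply Csum_ext_lt; intros k Hk.
    unfold madj; rewrite Cconj_mul, Cconj_invol, (HX i k), (HY i k) by assumption.
    apply C_ext; simpl; ring. }
  apply (f_equal snd) in Ht; simpl in Ht; lra.
Qed.

(* Column [a] lists the entries of the [a]-th basis element, scaled so that
   orthonormality says that this [N^2 x N^2] matrix is an isometry. *)
Definition onb_matrix : Mat :=
  fun p a => RtoC (sqrt (INR N)) * nth a B mzero (p / N)%nat (p mod N)%nat.

Lemma onb_matrix_entry i j a : (j < N)%nat ->
  onb_matrix (i * N + j)%nat a = RtoC (sqrt (INR N)) * nth a B mzero i j.
Proof.
  intros Hj; unfold onb_matrix; f_equal; f_equal; symmetry;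
    [apply Nat.div_unique with j|apply Nat.mod_unique with i]; lia.
Qed.

Lemma mid_flatten i j k l : (j < N)%nat -> (l < N)%nat ->
  mid (i * N + j)%nat (k * N + l)%nat = mid i k * mid j l.
Proof.
  intros Hj Hl; unfold mid.
  destruct (Nat.eqb_spec i k), (Nat.eqb_spec j l), (Nat.eqb_spec (i * N + j) (k * N + l));
    subst; try ring; exfalso; nia.
Qed.

Lemma onb_matrix_isometry : madj onb_matrix *[N * N] onb_matrix =[N * N] mid.
Proof.
  intros a b Ha Hb; destruct HB as [_ [_ Horth]].
  transitivity (RtoC (inner N (nth a B mzero) (nth b B mzero)));
    [|rewrite Horth by assumption; unfold mid; destruct (Nat.eqb a b); reflexivity].
  transitivity (RtoC (INR N) * mtrace N (madj (nth a B mzero) *[N] nth b B mzero)).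
  - unfold mtrace, mmul, madj; rewrite Csum_exchange, <- Csum_divmod, <- Csum_mul_l.
    apply Csum_ext; intros p _; unfold onb_matrix; set (c := sqrt (INR N)).
    replace (INR N) with (c * c)%R by apply sqrt_sqrt, pos_INR.
    apply C_ext; simpl; ring.
  - pose proof (skew_mtrace_real _ _ (onb_skew a Ha) (onb_skew b Hb)) as Hreal.
    apply C_ext; unfold inner; simpl; rewrite Hreal; ring.
Qed.

Lemma onb_sum_entries i j k l :
  (i < N)%nat -> (j < N)%nat -> (k < N)%nat -> (l < N)%nat ->
  \sum_(X in B) X i j * X k l = RtoC (- / INR N) * (mid i l * mid j k).
Proof.
  intros Hi Hj Hk Hl.
  rewrite <- mid_flatten, <- (isometry_coisometry _ _ onb_matrix_isometry) by nia.
  rewrite (Csum_nth _ B mzero), (proj1 HB); unfold mmul at 1; rewrite <- Csum_mul_l.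
  apply Csum_ext_lt; intros a Ha; unfold madj.
  rewrite !onb_matrix_entry, (onb_skew a Ha k l) by assumption.
  set (c := sqrt (INR N)); replace (INR N) with (c * c)%R by apply sqrt_sqrt, pos_INR.
  assert (Hc : c <> 0%R) by (apply Rgt_not_eq, sqrt_lt_R0, lt_0_INR; lia).
  apply C_ext; simpl; field; exact Hc.
Qed.

Lemma onb_sum_sandwich M : msum (fun X => X *[N] M *[N] X) B =[N] - ntr N M *: mid.
Proof.
  intros i j Hi Hj; unfold msum, mscale, mmul.
  transitivity (\sum_(c < N) \sum_(b < N)
    mid b c * (RtoC (- / INR N) * mid i j * M b c)).
  - rewrite Csum_exchange; apply Csum_ext_lt; intros c Hc.
    transitivity (\sum_(X in B) \sum_(b < N) M b c * (X i b * X c j)).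
    { apply Csum_ext; intros X _; rewrite <- Csum_mul_r; apply Csum_ext; intros; ring. }
    rewrite Csum_exchange; apply Csum_ext_lt; intros b Hb.
    rewrite Csum_mul_l, onb_sum_entries by assumption; ring.
  - rewrite Csum_exchange.
    rewrite (Csum_ext_lt _ (fun b => RtoC (- / INR N) * mid i j * M b b)).
    + rewrite Csum_mul_l, RtoC_opp; unfold ntr, mtrace; ring.
    + intros b Hb; apply (Csum_mid N (fun c => RtoC (- / INR N) * mid i j * M b c) b Hb).
Qed.

Lemma onb_sum_trace M :
  msum (fun X => ntr N (X *[N] M) *: X)%M B =[N] RtoC (- / (INR N * INR N)) *: M.
Proof.
  assert (HNR : INR N <> 0%R) by (apply not_0_INR; lia).
  intros i j Hi Hj; unfold msum, mscale.
  transitivity (RtoC (- / (INR N * INR N)) * \sum_(a < N) mid j a *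
    \sum_(b < N) mid i b * M b a).
  - transitivity (\sum_(X in B) \sum_(a < N) \sum_(b < N)
      RtoC (/ INR N) * M b a * (X a b * X i j)).
    { apply Csum_ext; intros X _; unfold ntr, mtrace, mmul.
      rewrite <- Csum_mul_l, <- Csum_mul_r; apply Csum_ext; intros a _.
      rewrite <- Csum_mul_l, <- Csum_mul_r; apply Csum_ext; intros; ring. }
    rewrite Csum_exchange, <- Csum_mul_l; apply Csum_ext_lt; intros a Ha.
    rewrite Csum_exchange, <- !Csum_mul_l; apply Csum_ext_lt; intros b Hb.
    rewrite Csum_mul_l, onb_sum_entries, (mid_sym a j), (mid_sym b i) by assumption.
    replace (- / (INR N * INR N))%R with (/ INR N * - / INR N)%R by (field; exact HNR).
    rewrite RtoC_mul; ring.
  - f_equal; rewrite (Csum_mid N (fun a => \sum_(b < N) mid i b * M b a) j Hj).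
    apply (Csum_mid N (fun b => M b j) i Hi).
Qed.

End OrthonormalBasis.

Local Close Scope cplx_scope.

(** * Polynomials modulo [peq] *)

Lemma nth_strip e j : nth j (strip e) 0%nat = nth j e 0%nat.
Proof.
  revert j; induction e as [|x l IH]; intros j; simpl; [reflexivity|].
  destruct (strip l) as [|y s] eqn:Hs.
  - assert (Hl : forall i, nth i l 0%nat = 0%nat)
      by (intros i; rewrite <- IH; destruct i; reflexivity).
    destruct (Nat.eqb_spec x 0) as [->|]; destruct j; simpl; rewrite ?Hl; try reflexivity.
    destruct j; reflexivity.
  - destruct j; [reflexivity|apply IH].
Qed.

Lemma strip_zero e : (forall j, nth j e 0%nat = 0%nat) -> strip e = [].
Proof.
  induction e as [|x l IH]; intros H; simpl; [reflexivity|].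
  rewrite IH by (intros j; exact (H (S j))).
  specialize (H 0%nat); simpl in H; subst x; reflexivity.
Qed.

Lemma strip_eq_iff a b :
  strip a = strip b <-> forall j, nth j a 0%nat = nth j b 0%nat.
Proof.
  split; [intros H j; rewrite <- (nth_strip a), H; apply nth_strip|].
  revert b; induction a as [|x a IH]; intros b H.
  - symmetry; apply strip_zero; intros j; rewrite <- H; destruct j; reflexivity.
  - destruct b as [|y b].
    + apply strip_zero; intros j; rewrite H; destruct j; reflexivity.
    + simpl; rewrite (IH b) by (intros j; exact (H (S j))).
      specialize (H 0%nat); simpl in H; subst y; reflexivity.
Qed.

Lemma strip_strip e : strip (strip e) = strip e.
Proof. apply strip_eq_iff, nth_strip. Qed.

Lemma nth_eadd a b j : nth j (eadd a b) 0%nat = (nth j a 0 + nth j b 0)%nat.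
Proof.
  revert b j; induction a as [|x a IH]; intros b j; simpl.
  - destruct j; reflexivity.
  - destruct b as [|y b]; [destruct j; simpl; lia|].
    destruct j; simpl; [reflexivity|apply IH].
Qed.

Lemma strip_eadd a b a' b' :
  strip a = strip a' -> strip b = strip b' -> strip (eadd a b) = strip (eadd a' b').
Proof.
  rewrite !strip_eq_iff; intros H H' j; rewrite !nth_eadd, H, H'; reflexivity.
Qed.

Lemma eadd_comm a b : eadd a b = eadd b a.
Proof.
  revert b; induction a as [|x a IH]; intros [|y b]; simpl; try reflexivity.
  rewrite IH; f_equal; lia.
Qed.

Lemma eadd_assoc a b c : eadd a (eadd b c) = eadd (eadd a b) c.
Proof.
  revert b c; induction a as [|x a IH]; intros [|y b] [|z c]; simpl; try reflexivity.
  rewrite IH; f_equal; lia.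
Qed.

Lemma expo_eqb_spec a b : reflect (strip a = strip b) (expo_eqb a b).
Proof.
  unfold expo_eqb; destruct (list_eq_dec Nat.eq_dec (strip a) (strip b));
    constructor; assumption.
Qed.

Definition strip_invariant {T : Type} (phi : expo -> T) : Prop :=
  forall a b, strip a = strip b -> phi a = phi b.

Lemma strip_invariant_nth j : strip_invariant (fun e => nth j e 0%nat).
Proof. intros a b H; apply strip_eq_iff, H. Qed.

Section LinearExtension.
Local Open Scope cplx_scope.
Implicit Types (phi psi : expo -> C) (p q : cpoly).

Definition linext (phi : expo -> C) (p : cpoly) : C :=
  \sum_(t in p) fst t * phi (snd t).

Lemma linext_ext_in phi psi p :
  (forall t, In t p -> phi (snd t) = psi (snd t)) -> linext phi p = linext psi p.
Proof. intros H; apply Csum_ext; intros t Ht; rewrite (H t Ht); reflexivity. Qed.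

Lemma linext_ext phi psi p : (forall e, phi e = psi e) -> linext phi p = linext psi p.
Proof. intros H; apply linext_ext_in; intros t _; apply H. Qed.

Lemma linext_add phi psi p :
  linext (fun e => phi e + psi e) p = linext phi p + linext psi p.
Proof. unfold linext; rewrite <- Csum_add; apply Csum_ext; intros; ring. Qed.

Lemma linext_exchange (phi : expo -> expo -> C) p q :
  linext (fun e => linext (phi e) q) p = linext (fun e' => linext (fun e => phi e e') p) q.
Proof.
  unfold linext.
  transitivity (\sum_(t in p) \sum_(t' in q) fst t * (fst t' * phi (snd t) (snd t'))).
  { apply Csum_ext; intros; rewrite <- Csum_mul_l; reflexivity. }
  rewrite Csum_exchange.
  apply Csum_ext; intros; rewrite <- Csum_mul_l; apply Csum_ext; intros; ring.
Qed.

Lemma linext_term phi c e : linext phi [(c, e)] = c * phi e.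
Proof. unfold linext; simpl; ring. Qed.

Lemma linext_padd phi p q : linext phi (padd p q) = linext phi p + linext phi q.
Proof. apply Csum_app. Qed.

Lemma linext_pscale phi c p : linext phi (pscale c p) = c * linext phi p.
Proof.
  unfold linext, pscale; rewrite map_map, <- Csum_mul_l.
  apply Csum_ext; intros t _; simpl; ring.
Qed.

Lemma linext_pmul phi p q :
  linext phi (pmul p q) = linext (fun e => linext (fun e' => phi (eadd e e')) q) p.
Proof.
  unfold linext, pmul; rewrite Csum_flat_map.
  apply Csum_ext; intros t _; rewrite map_map, <- Csum_mul_l.
  apply Csum_ext; intros t' _; simpl; ring.
Qed.

Lemma coef_cons t p m :
  coef (t :: p) m = (if expo_eqb (snd t) m then fst t else C0) + coef p m.
Proof. unfold coef; simpl; destruct (expo_eqb (snd t) m); simpl; [reflexivity|ring]. Qed.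

Lemma coef_linext p m : coef p m = linext (fun e => if expo_eqb e m then C1 else C0) p.
Proof.
  induction p as [|t p IH]; [reflexivity|].
  rewrite coef_cons, IH; unfold linext; simpl.
  destruct (expo_eqb (snd t) m); ring.
Qed.

Lemma linext_coef phi p ms : strip_invariant phi -> NoDup ms ->
  (forall m, In m ms -> strip m = m) -> (forall t, In t p -> In (strip (snd t)) ms) ->
  linext phi p = \sum_(m in ms) coef p m * phi m.
Proof.
  intros Hphi Hms Hstrip Hp.
  transitivity (linext (fun e => \sum_(m in ms) (if expo_eqb e m then C1 else C0) * phi m) p).
  - apply linext_ext_in; intros t Ht.
    rewrite (Csum_indicator (fun m => expo_eqb (snd t) m) phi ms (strip (snd t)));
      [apply Hphi; symmetry; apply strip_strip|exact Hms|apply Hp, Ht|].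
    intros m Hm; destruct (expo_eqb_spec (snd t) m) as [E|E]; rewrite (Hstrip m Hm) in E;
      split; congruence.
  - unfold linext.
    rewrite (Csum_ext _ (fun t => \sum_(m in ms)
      fst t * (if expo_eqb (snd t) m then C1 else C0) * phi m))
      by (intros; rewrite <- Csum_mul_l; apply Csum_ext; intros; ring).
    rewrite Csum_exchange; apply Csum_ext; intros m _; rewrite coef_linext.
    apply Csum_mul_r.
Qed.

Lemma peq_linext p q :
  peq p q <-> forall phi, strip_invariant phi -> linext phi p = linext phi q.
Proof.
  split.
  - intros H phi Hphi.
    set (ms := nodup (list_eq_dec Nat.eq_dec) (map (fun t => strip (snd t)) (p ++ q))).
    assert (Hms : NoDup ms) by apply NoDup_nodup.
    assert (Hstrip : forall m, In m ms -> strip m = m).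
    { intros m Hm; apply nodup_In, in_map_iff in Hm as [t [<- _]]; apply strip_strip. }
    assert (Hpq : forall t, In t (p ++ q) -> In (strip (snd t)) ms)
      by (intros t Ht; apply nodup_In, (in_map (fun t => strip (snd t))), Ht).
    rewrite !(linext_coef phi _ ms) by
      (try assumption; intros t Ht; apply Hpq, in_app_iff; tauto).
    apply Csum_ext; intros m _; rewrite H; reflexivity.
  - intros H m; rewrite !coef_linext; apply H; intros a b Hab.
    destruct (expo_eqb_spec a m), (expo_eqb_spec b m); congruence.
Qed.

End LinearExtension.

Global Instance peq_equivalence : Equivalence peq.
Proof.
  split; red; unfold peq; intros; try reflexivity.
  - symmetry; auto.
  - etransitivity; eauto.
Qed.

Declare Scope poly_scope.
Delimit Scope poly_scope with P.
Local Arguments padd (p q)%_P : simpl never.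
Local Arguments pmul (p q)%_P : simpl never.
Local Arguments pscale c%_c p%_P : simpl never.
Local Arguments peq (p q)%_P : simpl never.
Local Infix "+" := padd : poly_scope.
Local Infix "*" := pmul : poly_scope.
Local Infix "*:" := pscale (at level 40) : poly_scope.
Local Infix "==" := peq (at level 70) : poly_scope.
Local Open Scope poly_scope.

Global Instance padd_proper : Proper (peq ==> peq ==> peq) padd.
Proof.
  intros p p' Hp q q' Hq; rewrite peq_linext in *; intros phi H.
  rewrite !linext_padd, (Hp _ H), (Hq _ H); reflexivity.
Qed.

Global Instance pscale_proper c : Proper (peq ==> peq) (pscale c).
Proof.
  intros p p' Hp; rewrite peq_linext in *; intros phi H.
  rewrite !linext_pscale, (Hp _ H); reflexivity.
Qed.

Global Instance pmul_proper : Proper (peq ==> peq ==> peq) pmul.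
Proof.
  intros p p' Hp q q' Hq; rewrite peq_linext in *; intros phi H; rewrite !linext_pmul.
  rewrite (Hp (fun e => linext (fun e' => phi (eadd e e')) q)).
  - apply linext_ext; intros e; apply Hq; intros a b Hab.
    apply H, strip_eadd; [reflexivity|exact Hab].
  - intros a b Hab; apply linext_ext; intros e.
    apply H, strip_eadd; [exact Hab|reflexivity].
Qed.

Definition pconst (c : C) : cpoly := [(c, [])].
Definition popp (p : cpoly) : cpoly := Copp C1 *: p.

Lemma cpoly_ring_theory :
  ring_theory (R := cpoly) [] (pconst C1) padd pmul (fun p q => p + popp q) popp peq.
Proof.
  constructor; intros; try reflexivity; apply peq_linext; intros phi H;
    rewrite ?linext_padd, ?linext_pmul, ?linext_padd.
  - ring.
  - ring.
  - unfold pconst; rewrite linext_term; change (linext _ x) with (linext phi x) at 1; ring.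
  - rewrite linext_exchange; apply linext_ext; intros e; apply linext_ext; intros e'.
    rewrite eadd_comm; reflexivity.
  - apply linext_ext; intros e; rewrite linext_pmul; apply linext_ext; intros e'.
    apply linext_ext; intros e''; rewrite eadd_assoc; reflexivity.
  - reflexivity.
  - unfold popp; rewrite linext_pscale; unfold linext; simpl; ring.
Qed.

Lemma cpoly_ring_ext : ring_eq_ext padd pmul popp peq.
Proof. constructor; exact _. Qed.

Add Ring cpoly_ring : cpoly_ring_theory (setoid peq_equivalence cpoly_ring_ext).

Lemma peq_single a b : strip a = strip b -> [(C1, a)] == [(C1, b)].
Proof.
  intros H; apply peq_linext; intros phi Hphi; rewrite !linext_term, (Hphi _ _ H).
  reflexivity.
Qed.

Lemma pmul_single a b : [(C1, a)] * [(C1, b)] == [(C1, eadd a b)].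
Proof. apply peq_linext; intros phi Hphi; rewrite linext_pmul, !linext_term; ring. Qed.

Lemma peq_cons c e p : (c, e) :: p == c *: [(C1, e)] + p.
Proof.
  apply peq_linext; intros phi Hphi; rewrite linext_padd, linext_pscale, linext_term.
  unfold linext; simpl; ring.
Qed.

Lemma padd_diag_eq0 p : p == p + p -> p == [].
Proof.
  intros H m; specialize (H m); rewrite !coef_linext, linext_padd in *.
  set (x := linext _ p) in *; change (linext _ []) with C0.
  transitivity (Cadd (Cadd x x) (Copp x)); [ring|rewrite <- H; ring].
Qed.

Definition drop_u (p : cpoly) : cpoly :=
  filter (fun t : term => Nat.eqb (nth 0 (snd t) 0%nat) 0) p.

Lemma coef_drop_u p m :
  coef (drop_u p) m = if Nat.eqb (nth 0 m 0%nat) 0 then coef p m else C0.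
Proof.
  unfold drop_u; induction p as [|t p IH]; cbn [filter].
  - destruct (Nat.eqb (nth 0 m 0%nat) 0); reflexivity.
  - destruct (Nat.eqb_spec (nth 0 (snd t) 0%nat) 0) as [Ht|Ht]; rewrite ?coef_cons, IH;
      destruct (expo_eqb_spec (snd t) m) as [Hm|Hm];
      try apply (strip_invariant_nth 0) in Hm;
      destruct (Nat.eqb_spec (nth 0 m 0%nat) 0); try ring; congruence.
Qed.

Lemma scalar_drop_u p : scalar p -> p == drop_u p.
Proof.
  intros Hp m; rewrite coef_drop_u.
  destruct (Nat.eqb_spec (nth 0 m 0%nat) 0) as [|Hm]; [reflexivity|apply Hp, Hm].
Qed.

(** * The variables of a monomial *)

Fixpoint gens_from (j : nat) (l : list nat) : list nat :=
  match l with
  | [] => []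
  | x :: l => repeat j x ++ gens_from (S j) l
  end.

(* The indices of the [v_j] in the monomial, listed with multiplicity: functions of
   this list respect [strip] on the nose. *)
Definition gens (e : expo) : list nat := gens_from 1 (tl e).

Lemma gens_from_strip j l : gens_from j (strip l) = gens_from j l.
Proof.
  revert j; induction l as [|x l IH]; intros j; simpl; [reflexivity|].
  rewrite <- IH; destruct (strip l) as [|y s]; [|reflexivity].
  destruct (Nat.eqb_spec x 0) as [->|]; reflexivity.
Qed.

Lemma gens_strip e : gens (strip e) = gens e.
Proof.
  destruct e as [|x l]; [reflexivity|]; unfold gens; simpl.
  rewrite <- (gens_from_strip 1 l); destruct (strip l); [|reflexivity].
  destruct (Nat.eqb x 0); reflexivity.
Qed.

Lemma strip_invariant_gens : strip_invariant gens.
Proof. intros a b H; rewrite <- (gens_strip a), H; apply gens_strip. Qed.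

Lemma strip_invariant_monomial {T} (F : nat -> list nat -> T) :
  strip_invariant (fun e => F (nth 0 e 0%nat) (gens e)).
Proof.
  intros a b H; rewrite (strip_invariant_nth 0 a b H), (strip_invariant_gens a b H).
  reflexivity.
Qed.

Lemma count_occ_gens_from s l i :
  count_occ Nat.eq_dec (gens_from s l) i =
  if (i <? s)%nat then 0%nat else nth (i - s) l 0%nat.
Proof.
  revert s; induction l as [|x l IH]; intros s; simpl.
  - destruct (i <? s)%nat, (i - s)%nat; reflexivity.
  - rewrite count_occ_app, IH.
    destruct (Nat.eq_dec s i) as [->|Hi].
    + rewrite count_occ_repeat_eq by reflexivity.
      rewrite Nat.ltb_irrefl, Nat.sub_diag.
      replace (i <? S i)%nat with true by (symmetry; apply Nat.ltb_lt; lia); lia.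
    + rewrite count_occ_repeat_neq by congruence.
      destruct (Nat.ltb_spec i s), (Nat.ltb_spec i (S s)); try lia.
      replace (i - s)%nat with (S (i - S s)) by lia; reflexivity.
Qed.

Lemma count_occ_gens e i :
  count_occ Nat.eq_dec (gens e) i = if Nat.eqb i 0 then 0%nat else nth i e 0%nat.
Proof.
  unfold gens; rewrite count_occ_gens_from.
  destruct i as [|i]; [reflexivity|]; simpl; rewrite Nat.sub_0_r.
  destruct e; [destruct i|]; reflexivity.
Qed.

Lemma gens_pos e : Forall (le 1) (gens e).
Proof.
  apply Forall_forall; intros j Hj.
  apply (count_occ_In Nat.eq_dec) in Hj; rewrite count_occ_gens in Hj.
  destruct j; simpl in Hj; lia.
Qed.

Lemma gens_eadd a b : Permutation (gens (eadd a b)) (gens a ++ gens b).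
Proof.
  apply (Permutation_count_occ Nat.eq_dec); intros i.
  rewrite count_occ_app, !count_occ_gens, nth_eadd; destruct (Nat.eqb i 0); reflexivity.
Qed.

Lemma gens_pv k : (1 <= k)%nat -> gens (repeat 0%nat k ++ [1%nat]) = [k].
Proof.
  intros Hk; destruct k as [|k]; [lia|]; unfold gens; simpl; clear Hk.
  change (S k) with (1 + k)%nat; generalize 1%nat at 1 3 as s.
  induction k as [|k IH]; intros s; simpl; [rewrite Nat.add_0_r; reflexivity|].
  rewrite IH; f_equal; lia.
Qed.

Lemma nth_repeat_1 j i :
  nth i (repeat 0%nat j ++ [1%nat]) 0%nat = if Nat.eqb i j then 1%nat else 0%nat.
Proof.
  revert i; induction j as [|j IH]; intros [|i]; simpl; try reflexivity.
  - destruct i; reflexivity.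
  - apply IH.
Qed.

Fixpoint vprod (l : list nat) : cpoly :=
  match l with
  | [] => pconst C1
  | j :: l => pv j * vprod l
  end.

Definition mono (k : nat) (l : list nat) : cpoly := pu k * vprod l.

Definition vexpo (l : list nat) : expo :=
  fold_right (fun j => eadd (repeat 0%nat j ++ [1%nat])) [] l.

Lemma vprod_single l : vprod l == [(C1, vexpo l)].
Proof.
  induction l as [|j l IH]; simpl; [reflexivity|].
  rewrite IH; apply pmul_single.
Qed.

Lemma nth_vexpo l i : nth i (vexpo l) 0%nat = count_occ Nat.eq_dec l i.
Proof.
  induction l as [|j l IH]; simpl; [destruct i; reflexivity|].
  rewrite nth_eadd, nth_repeat_1, IH.
  destruct (Nat.eqb_spec i j), (Nat.eq_dec j i); congruence || lia.
Qed.

Lemma single_mono e : [(C1, e)] == mono (nth 0 e 0%nat) (gens e).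
Proof.
  unfold mono; rewrite vprod_single; unfold pu; rewrite pmul_single.
  apply peq_single, strip_eq_iff; intros i.
  rewrite nth_eadd, nth_vexpo, count_occ_gens; destruct i as [|[|i]]; simpl; lia.
Qed.

Lemma scalar_vprod l : Forall (le 1) l -> scalar (vprod l).
Proof.
  intros Hl m Hm; rewrite vprod_single, coef_linext, linext_term.
  destruct (expo_eqb_spec (vexpo l) m) as [E|_]; [|ring].
  apply (strip_invariant_nth 0) in E; rewrite nth_vexpo in E.
  exfalso; apply Hm; rewrite <- E; apply count_occ_not_In; intros H0.
  rewrite Forall_forall in Hl; specialize (Hl _ H0); lia.
Qed.

Lemma scalar_pv k : (1 <= k)%nat -> scalar (pv k).
Proof.
  intros Hk m Hm; rewrite <- (scalar_vprod [k] (Forall_cons _ Hk (Forall_nil _)) m Hm).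
  assert (H : pv k == vprod [k]) by (simpl; ring); apply H.
Qed.

Lemma vprod_app l l' : vprod (l ++ l') == vprod l * vprod l'.
Proof. induction l as [|j l IH]; simpl; [|rewrite IH]; ring. Qed.

Lemma vprod_perm l l' : Permutation l l' -> vprod l == vprod l'.
Proof.
  induction 1 as [|j l l' _ IH|i j l|l l' l'' _ IH _ IH']; simpl.
  - reflexivity.
  - rewrite IH; reflexivity.
  - ring.
  - rewrite IH; exact IH'.
Qed.

Lemma pu_0 : pu 0 == pconst C1.
Proof. apply peq_single; reflexivity. Qed.

Lemma mono_nil k : mono k [] == pu k.
Proof. unfold mono; simpl; ring. Qed.

Lemma mono_cons k j l : mono k (j :: l) == pv j * mono k l.
Proof. unfold mono; simpl; ring. Qed.

(** * The operators *)

Fixpoint vprod_der (d : nat -> cpoly) (l : list nat) : cpoly :=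
  match l with
  | [] => []
  | j :: l => d j * vprod l + pv j * vprod_der d l
  end.

(* The value at [u^k v_l1 ... v_lr] of the operator that sends [u^k] to [a k] and [v_j]
   to [d j] and satisfies the Leibniz rule when one of the factors is scalar. *)
Definition mono_der (a d : nat -> cpoly) (k : nat) (l : list nat) : cpoly :=
  a k * vprod l + pu k * vprod_der d l.

Section MonomialDerivation.
Variables a d : nat -> cpoly.

Lemma vprod_der_app l l' :
  vprod_der d (l ++ l') == vprod_der d l * vprod l' + vprod l * vprod_der d l'.
Proof. induction l as [|j l IH]; simpl; [|rewrite IH, vprod_app]; ring. Qed.

Lemma vprod_der_perm l l' : Permutation l l' -> vprod_der d l == vprod_der d l'.
Proof.
  induction 1 as [|j l l' H IH|i j l|l l' l'' _ IH _ IH']; simpl.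
  - reflexivity.
  - rewrite IH, (vprod_perm _ _ H); reflexivity.
  - ring.
  - rewrite IH; exact IH'.
Qed.

Lemma mono_der_nil k : mono_der a d k [] == a k.
Proof. unfold mono_der; simpl; ring. Qed.

Lemma mono_der_cons k j l :
  mono_der a d k (j :: l) == d j * mono k l + pv j * mono_der a d k l.
Proof. unfold mono_der, mono; simpl; ring. Qed.

Lemma mono_der_eadd e e' : a 0%nat == [] -> nth 0 e 0%nat = 0%nat ->
  mono_der a d (nth 0 (eadd e e') 0%nat) (gens (eadd e e')) ==
  mono_der a d (nth 0 e 0%nat) (gens e) * [(C1, e')] +
  [(C1, e)] * mono_der a d (nth 0 e' 0%nat) (gens e').
Proof.
  intros Ha He; unfold mono_der.
  rewrite (single_mono e), (single_mono e'); unfold mono.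
  rewrite (vprod_perm _ _ (gens_eadd e e')), (vprod_der_perm _ _ (gens_eadd e e')).
  rewrite vprod_app, vprod_der_app, nth_eadd, He, Nat.add_0_l, Ha, pu_0; ring.
Qed.

End MonomialDerivation.

Definition polyext (M : expo -> cpoly) (p : cpoly) : cpoly :=
  flat_map (fun t => fst t *: M (snd t)) p.

Lemma linext_polyext phi M p : linext phi (polyext M p) = linext (fun e => linext phi (M e)) p.
Proof.
  unfold polyext, linext at 1; rewrite Csum_flat_map.
  apply Csum_ext; intros t _; apply linext_pscale.
Qed.

Lemma polyext_single M e : polyext M [(C1, e)] == M e.
Proof. apply peq_linext; intros phi _; rewrite linext_polyext, linext_term; ring. Qed.

Lemma plinear_polyext M : strip_invariant M -> plinear (polyext M).
Proof.
  intros HM; split; [|split]; intros; rewrite peq_linext in *; intros phi Hphi;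
    rewrite ?linext_padd, ?linext_pscale, ?linext_polyext, ?linext_padd, ?linext_pscale;
    try reflexivity.
  apply H; intros a b Hab; rewrite (HM _ _ Hab); reflexivity.
Qed.

Lemma polyext_pmul_scalar M p q : strip_invariant M ->
  (forall e e', nth 0 e 0%nat = 0%nat ->
    M (eadd e e') == M e * [(C1, e')] + [(C1, e)] * M e') ->
  scalar p -> polyext M (p * q) == polyext M p * q + p * polyext M q.
Proof.
  intros HM Hleibniz Hp.
  assert (Hproper : Proper (peq ==> peq) (polyext M)) by exact (proj1 (plinear_polyext M HM)).
  rewrite (scalar_drop_u p Hp); apply peq_linext; intros phi Hphi.
  rewrite linext_padd, linext_polyext, !linext_pmul, linext_polyext, <- linext_add.
  apply linext_ext_in; intros t Ht.
  apply filter_In in Ht as [_ Ht]; apply Nat.eqb_eq in Ht.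
  rewrite linext_polyext, linext_exchange, <- linext_add.
  apply linext_ext; intros e.
  rewrite (proj1 (peq_linext _ _) (Hleibniz (snd t) e Ht) phi Hphi).
  rewrite linext_padd, !linext_pmul, linext_term; f_equal; [|ring].
  apply linext_ext; intros e'; rewrite linext_term; ring.
Qed.

Lemma plinear_nil D : plinear D -> D [] == [].
Proof.
  intros [_ [Hadd _]]; apply padd_diag_eq0; rewrite <- Hadd; reflexivity.
Qed.

Lemma plinear_eq D D' : plinear D -> plinear D' ->
  (forall e, D [(C1, e)] == D' [(C1, e)]) -> forall p, D p == D' p.
Proof.
  intros HD HD' H p; pose proof HD as [Dext [Dadd Dscale]].
  pose proof HD' as [D'ext [D'add D'scale]].
  induction p as [|[c e] p IH].
  - rewrite (plinear_nil D HD), (plinear_nil D' HD'); reflexivity.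
  - rewrite (Dext _ _ (peq_cons c e p)), (D'ext _ _ (peq_cons c e p)).
    rewrite Dadd, D'add, Dscale, D'scale, H, IH; reflexivity.
Qed.

Definition Du (k : nat) : cpoly :=
  RtoC (- INR k) *: pu k +
  RtoC (-2) *: psum (map (fun m => RtoC (INR m) *: (pu m * pv (k - m))) (seq 1 (k - 1))).

Definition Dv (k : nat) : cpoly :=
  RtoC (- INR k) *: pv k +
  RtoC (-2) *: psum (map (fun m => RtoC (INR m) *: (pv m * pv (k - m))) (seq 1 (k - 1))).

Definition Dmono : nat -> list nat -> cpoly := mono_der Du Dv.

(* [- N^2] times the carre du champ [sum_X (X~ tr U^j) (X~ _)]. *)
Definition cross (j : nat) : nat -> list nat -> cpoly :=
  mono_der (fun k => RtoC (INR j * INR k) *: pu (j + k))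
           (fun i => RtoC (INR j * INR i) *: pv (j + i)).

Lemma Dmono_nil k : Dmono k [] == Du k.
Proof. apply mono_der_nil. Qed.

Lemma Dmono_cons k j l : Dmono k (j :: l) == Dv j * mono k l + pv j * Dmono k l.
Proof. apply mono_der_cons. Qed.

Lemma cross_nil j k : cross j k [] == RtoC (INR j * INR k) *: pu (j + k).
Proof. apply mono_der_nil. Qed.

Lemma cross_cons j k i l :
  cross j k (i :: l) == RtoC (INR j * INR i) *: pv (j + i) * mono k l + pv i * cross j k l.
Proof. apply mono_der_cons. Qed.

Fixpoint Lmono (k : nat) (l : list nat) : cpoly :=
  match l with
  | [] => []
  | j :: l => RtoC 2 *: cross j k l + pv j * Lmono k l
  end.

Definition opD : cpoly -> cpoly := polyext (fun e => Dmono (nth 0 e 0%nat) (gens e)).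
Definition opL : cpoly -> cpoly := polyext (fun e => Lmono (nth 0 e 0%nat) (gens e)).

Lemma plinear_opD : plinear opD.
Proof. apply plinear_polyext, strip_invariant_monomial. Qed.

Global Instance opD_proper : Proper (peq ==> peq) opD := proj1 plinear_opD.

Lemma plinear_opL : plinear opL.
Proof. apply plinear_polyext, strip_invariant_monomial. Qed.

Lemma Du_0 : Du 0 == [].
Proof.
  apply peq_linext; intros phi Hphi; unfold Du; rewrite linext_padd, !linext_pscale.
  change (INR 0) with 0%R; rewrite RtoC_opp; change (RtoC 0) with C0.
  unfold linext; simpl; ring.
Qed.

Lemma opD_pmul_scalar p q : scalar p -> opD (p * q) == opD p * q + p * opD q.
Proof.
  apply polyext_pmul_scalar; [apply strip_invariant_monomial|].
  intros e e'; apply mono_der_eadd, Du_0.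
Qed.

Lemma opD_props : D_props opD.
Proof.
  split; [|split].
  - intros k _; unfold pu at 1, opD; rewrite polyext_single; apply Dmono_nil.
  - intros k Hk; unfold pv at 1, opD; rewrite polyext_single, gens_pv, nth_repeat_1 by exact Hk.
    replace (Nat.eqb 0 k) with false by (symmetry; apply Nat.eqb_neq; lia).
    rewrite Dmono_cons, Dmono_nil, Du_0, mono_nil.
    rewrite pu_0; fold (Dv k); ring.
  - intros p q [H|H]; [apply opD_pmul_scalar, H|].
    assert (Hc : p * q == q * p) by ring.
    rewrite Hc, opD_pmul_scalar by exact H; ring.
Qed.

Section Uniqueness.
Variable D : cpoly -> cpoly.
Hypothesis linD : plinear D.
Hypothesis propsD : D_props D.

Let D_ext : Proper (peq ==> peq) D := proj1 linD.
Local Existing Instance D_ext.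

Lemma D_props_one : D (pconst C1) == [].
Proof.
  apply padd_diag_eq0.
  assert (H : pconst C1 == pconst C1 * pconst C1) by ring.
  rewrite H at 1; rewrite (proj2 (proj2 propsD)); [ring|].
  left; exact (scalar_vprod [] (Forall_nil _)).
Qed.

Lemma D_props_pu k : D (pu k) == Du k.
Proof.
  destruct k as [|k]; [rewrite Du_0, pu_0; apply D_props_one|].
  apply (proj1 propsD); lia.
Qed.

Lemma D_props_vprod l : Forall (le 1) l -> D (vprod l) == vprod_der Dv l.
Proof.
  induction 1 as [|j l Hj _ IH]; simpl; [apply D_props_one|].
  rewrite (proj2 (proj2 propsD)) by (left; apply scalar_pv, Hj).
  rewrite IH, (proj1 (proj2 propsD)) by exact Hj; reflexivity.
Qed.

Lemma D_props_unique p : D p == opD p.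
Proof.
  revert p; apply plinear_eq; [exact linD|exact plinear_opD|]; intros e.
  unfold opD; rewrite polyext_single, single_mono; unfold mono.
  rewrite (proj2 (proj2 propsD)) by (right; apply scalar_vprod, gens_pos).
  rewrite D_props_pu, D_props_vprod by apply gens_pos; reflexivity.
Qed.

End Uniqueness.

Local Close Scope poly_scope.

(** * Complex-valued functions of a real variable *)

Definition is_Cderive (f : R -> C) (x : R) (l : C) : Prop :=
  derivable_pt_lim (fun s => fst (f s)) x (fst l) /\
  derivable_pt_lim (fun s => snd (f s)) x (snd l).

Lemma is_Cderive_const c x : is_Cderive (fun _ => c) x C0.
Proof. split; apply derivable_pt_lim_const. Qed.

Lemma is_Cderive_add f g x l m : is_Cderive f x l -> is_Cderive g x m ->
  is_Cderive (fun s => f s + g s)%c x (l + m)%c.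
Proof.
  intros [F1 F2] [G1 G2]; split; simpl.
  - apply (derivable_pt_lim_plus _ _ _ _ _ F1 G1).
  - apply (derivable_pt_lim_plus _ _ _ _ _ F2 G2).
Qed.

Lemma is_Cderive_mul f g x l m : is_Cderive f x l -> is_Cderive g x m ->
  is_Cderive (fun s => f s * g s)%c x (l * g x + f x * m)%c.
Proof.
  intros [F1 F2] [G1 G2]; split; simpl.
  - replace (_ + _) with ((fst l * fst (g x) + fst (f x) * fst m) -
      (snd l * snd (g x) + snd (f x) * snd m)) by ring.
    apply (derivable_pt_lim_minus _ _ _ _ _
      (derivable_pt_lim_mult _ _ _ _ _ F1 G1) (derivable_pt_lim_mult _ _ _ _ _ F2 G2)).
  - replace (_ + _) with ((fst l * snd (g x) + fst (f x) * snd m) +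
      (snd l * fst (g x) + snd (f x) * fst m)) by ring.
    apply (derivable_pt_lim_plus _ _ _ _ _
      (derivable_pt_lim_mult _ _ _ _ _ F1 G2) (derivable_pt_lim_mult _ _ _ _ _ F2 G1)).
Qed.

Lemma is_Cderive_mul_l c f x l : is_Cderive f x l -> is_Cderive (fun s => c * f s)%c x (c * l)%c.
Proof.
  intros Hf; replace (c * l)%c with (C0 * f x + c * l)%c by ring.
  apply (is_Cderive_mul (fun _ => c)); [apply is_Cderive_const|exact Hf].
Qed.

Lemma is_Cderive_sum {T} (f : T -> R -> C) x (l : T -> C) ts :
  (forall t, In t ts -> is_Cderive (f t) x (l t)) ->
  is_Cderive (fun s => \sum_(t in ts) f t s)%c x (\sum_(t in ts) l t)%c.
Proof.
  intros H; induction ts as [|t ts IH]; simpl; [apply is_Cderive_const|].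
  apply is_Cderive_add; [apply H; left; reflexivity|].
  apply IH; intros t' Ht'; apply H; right; exact Ht'.
Qed.

(** * The exponential of a matrix *)

Lemma Cmod_Csum_le {T} (f : T -> C) l M :
  (forall x, In x l -> Complex.Cmod (f x) <= M) ->
  Complex.Cmod (\sum_(x in l) f x)%c <= INR (length l) * M.
Proof.
  intros H; induction l as [|x l IH].
  - simpl; change C0 with (Complex.RtoC 0); rewrite Complex.Cmod_0; lra.
  - cbn [map Csum fold_right length]; rewrite S_INR.
    pose proof (Complex.Cmod_triangle (f x) (\sum_(x in l) f x)%c) as Htri.
    specialize (IH (fun y Hy => H y (or_intror Hy))).
    specialize (H x (or_introl eq_refl)).
    change (Complex.Cmod (f x + \sum_(x in l) f x)%c <= (INR (length l) + 1) * M).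
    change Complex.Cplus with Cadd in Htri; lra.
Qed.

Lemma matrix_bound (X : Mat) N :
  exists M, 0 <= M /\ forall i j, (i < N)%nat -> (j < N)%nat -> Complex.Cmod (X i j) <= M.
Proof.
  set (moduli := map (fun p => Complex.Cmod (X (fst p) (snd p)))
    (list_prod (seq 0 N) (seq 0 N))).
  exists (Rmax 0 (MaxRlist moduli)); split; [apply Rmax_l|]; intros i j Hi Hj.
  apply Rle_trans with (MaxRlist moduli); [apply MaxRlist_P1|apply Rmax_r].
  apply (in_map (fun p => Complex.Cmod (X (fst p) (snd p))) _ (i, j)).
  apply in_prod; apply in_seq; lia.
Qed.

Lemma mpow_bound (X : Mat) N :
  exists K, forall n i j, (i < N)%nat -> (j < N)%nat -> Complex.Cmod (mpow N X n i j) <= K ^ n.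
Proof.
  destruct (matrix_bound X N) as [M [HM H]]; exists (INR N * M).
  induction n as [|n IH]; intros i j Hi Hj; simpl.
  - unfold mid; destruct (Nat.eqb i j);
      [change C1 with (Complex.RtoC 1)|change C0 with (Complex.RtoC 0)];
      rewrite ?Complex.Cmod_0, ?Complex.Cmod_1; lra.
  - eapply Rle_trans; [apply Cmod_Csum_le with (M := M * (INR N * M) ^ n)|
      rewrite length_seq; lra].
    intros k Hk; apply in_seq in Hk.
    change Cmul with Complex.Cmult; rewrite Complex.Cmod_mult.
    apply Rmult_le_compat; try apply Complex.Cmod_ge_0; [apply H|apply IH]; lia.
Qed.

Lemma CV_radius_factorial (a : nat -> R) K :
  (forall n, Rabs (a n) <= K ^ n / INR (fact n)) -> CV_radius a = p_infty.
Proof.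
  intros H.
  assert (Hr : forall r, 0 <= r -> Rbar_le (Finite r) (CV_radius a)).
  { intros r Hr.
    apply (proj1 (CV_radius_bounded a)).
    destruct (maj_by_pos (fun n => (K * r) ^ n / INR (fact n))) as [M [_ HM]].
    { exists 0; apply cv_speed_pow_fact. }
    exists M; intros n; specialize (HM n); specialize (H n).
    rewrite Rabs_mult, <- RPow_abs, (Rabs_pos_eq r Hr).
    eapply Rle_trans; [apply Rmult_le_compat_r; [apply pow_le; exact Hr|exact H]|].
    eapply Rle_trans; [|exact HM].
    eapply Rle_trans; [|apply Rle_abs].
    rewrite Rpow_mult_distr; unfold Rdiv; right; ring. }
  destruct (CV_radius a) as [x| |]; [exfalso|reflexivity|exfalso].
  - specialize (Hr (Rabs x + 1)); simpl in Hr.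
    pose proof (Rabs_pos x); pose proof (Rle_abs x); lra.
  - specialize (Hr 0 (Rle_refl 0)); exact Hr.
Qed.

Lemma mpow_mscale N s X n : mpow N (RtoC s *: X)%M n =[N] (RtoC (s ^ n) *: mpow N X n)%M.
Proof.
  induction n as [|n IH]; simpl.
  - intros i j _ _; unfold mscale; change (RtoC 1) with C1; ring.
  - rewrite IH, mmul_mscale_l, mmul_mscale_r, mscale_mscale, RtoC_mul; reflexivity.
Qed.

(* The entries of the exponential are treated through their real and imaginary parts,
   both of which are functionals of this kind. *)
Definition contractive (phi : C -> R) : Prop :=
  (forall a b, phi (a + b)%c = phi a + phi b) /\
  (forall r a, phi (RtoC r * a)%c = r * phi a) /\
  (forall a, Rabs (phi a) <= Complex.Cmod a).

Lemma contractive_fst : contractive fst.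
Proof.
  split; [reflexivity|split; [intros; simpl; ring|exact Complex.re_le_Cmod]].
Qed.

Lemma contractive_snd : contractive snd.
Proof.
  split; [reflexivity|split; [intros; simpl; ring|]]; intros a.
  eapply Rle_trans; [apply Rmax_r|apply Complex.Rmax_Cmod].
Qed.

Definition expcoef (phi : C -> R) (N : nat) (X : Mat) (i j n : nat) : R :=
  / INR (fact n) * phi (mpow N X n i j).

Section ExponentialCurve.
Variables (N : nat) (X : Mat) (i j : nat).
Hypotheses (Hi : (i < N)%nat) (Hj : (j < N)%nat).

Lemma CV_radius_expcoef phi : contractive phi -> CV_radius (expcoef phi N X i j) = p_infty.
Proof.
  intros [_ [_ Hphi]]; destruct (mpow_bound X N) as [K HK].
  apply CV_radius_factorial with K; intros n; unfold expcoef.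
  pose proof (Rinv_0_lt_compat _ (INR_fact_lt_0 n)) as Hfact.
  rewrite Rabs_mult, (Rabs_pos_eq (/ _)), Rmult_comm by lra.
  apply Rmult_le_compat_r; [lra|].
  eapply Rle_trans; [apply Hphi|apply HK; assumption].
Qed.

Lemma sum_expcoef phi s n : contractive phi ->
  sum_n (fun m => expcoef phi N X i j m * s ^ m) n =
  phi (exp_partial N (RtoC s *: X)%M n i j).
Proof.
  intros [Hadd [Hscale _]]; induction n as [|n IH].
  - rewrite sum_O; unfold expcoef; simpl; field_simplify; reflexivity.
  - rewrite sum_Sn, IH; cbn [exp_partial]; unfold madd; rewrite Hadd; unfold mscale at 3.
    rewrite Hscale, mpow_mscale by assumption; unfold mscale; rewrite Hscale.
    unfold expcoef, plus; simpl; ring.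
Qed.

Lemma exp_partial_cv phi s : contractive phi ->
  Un_cv (fun n => phi (exp_partial N (RtoC s *: X)%M n i j)) (PSeries (expcoef phi N X i j) s).
Proof.
  intros Hphi; apply is_lim_seq_Reals.
  apply is_lim_seq_ext with (sum_n (fun m => expcoef phi N X i j m * s ^ m)).
  { intros n; apply sum_expcoef, Hphi. }
  apply (proj1 (is_pseries_R _ _ _)), PSeries_correct, CV_radius_inside.
  rewrite CV_radius_expcoef by exact Hphi; exact I.
Qed.

End ExponentialCurve.

Section ExponentialDerivative.
Variables (N : nat) (X : Mat).

Lemma is_expm_expm s : is_expm N (RtoC s *: X)%M (expm N (RtoC s *: X)%M).
Proof.
  apply (epsilon_spec (inhabits mzero) (is_expm N (RtoC s *: X)%M)).
  exists (fun i j => (PSeries (expcoef fst N X i j) s, PSeries (expcoef snd N X i j) s)).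
  intros i j Hi Hj; split; apply exp_partial_cv; auto using contractive_fst, contractive_snd.
Qed.

Lemma fst_expm s i j : (i < N)%nat -> (j < N)%nat ->
  fst (expm N (RtoC s *: X)%M i j) = PSeries (expcoef fst N X i j) s.
Proof.
  intros Hi Hj; apply UL_sequence with (1 := proj1 (is_expm_expm s i j Hi Hj)).
  apply exp_partial_cv; [exact Hi|exact Hj|exact contractive_fst].
Qed.

Lemma snd_expm s i j : (i < N)%nat -> (j < N)%nat ->
  snd (expm N (RtoC s *: X)%M i j) = PSeries (expcoef snd N X i j) s.
Proof.
  intros Hi Hj; apply UL_sequence with (1 := proj2 (is_expm_expm s i j Hi Hj)).
  apply exp_partial_cv; [exact Hi|exact Hj|exact contractive_snd].
Qed.

Lemma expm_0 : expm N (RtoC 0 *: X)%M =[N] mid.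
Proof.
  intros i j Hi Hj; apply C_ext; [rewrite fst_expm by assumption|rewrite snd_expm by assumption];
    rewrite PSeries_0; unfold expcoef; simpl; field.
Qed.

Lemma PSeries_expcoef_derive phi i j : contractive phi -> (i < N)%nat -> (j < N)%nat ->
  is_derive (PSeries (expcoef phi N X i j)) 0 (phi (X i j)).
Proof.
  intros Hphi Hi Hj.
  replace (phi (X i j)) with (PSeries (PS_derive (expcoef phi N X i j)) 0).
  - apply is_derive_PSeries; rewrite CV_radius_expcoef by assumption; exact I.
  - rewrite PSeries_0; unfold PS_derive, expcoef; rewrite mpow_1 by assumption; simpl; field.
Qed.

Lemma expm_derive i j : (i < N)%nat -> (j < N)%nat ->
  is_Cderive (fun s => expm N (RtoC s *: X)%M i j) 0 (X i j).
Proof.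
  intros Hi Hj; split; apply is_derive_Reals; eapply is_derive_ext.
  - intros s; symmetry; apply fst_expm; assumption.
  - apply PSeries_expcoef_derive; [exact contractive_fst|exact Hi|exact Hj].
  - intros s; symmetry; apply snd_expm; assumption.
  - apply PSeries_expcoef_derive; [exact contractive_snd|exact Hi|exact Hj].
Qed.

End ExponentialDerivative.

(** * Derivatives along left-invariant vector fields *)

Local Open Scope cplx_scope.

Lemma rderiv_eq g s l : derivable_pt_lim g s l -> rderiv g s = l.
Proof.
  intros H; apply (uniqueness_limite g s); [|exact H].
  apply (epsilon_spec (inhabits 0%R) (fun l => derivable_pt_lim g s l)); exists l; exact H.
Qed.

(* A class of functions that is stable under [Xtilde N X], so that second derivatives need
   no separate differentiability argument. *)
Inductive entry_polynomial (N : nat) : (Mat -> C) -> Prop :=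
  | entry_polynomial_const c : entry_polynomial N (fun _ => c)
  | entry_polynomial_entry i j : (i < N)%nat -> (j < N)%nat ->
      entry_polynomial N (fun V => V i j)
  | entry_polynomial_add f g : entry_polynomial N f -> entry_polynomial N g ->
      entry_polynomial N (fun V => f V + g V)
  | entry_polynomial_mul f g : entry_polynomial N f -> entry_polynomial N g ->
      entry_polynomial N (fun V => f V * g V).

Lemma entry_polynomial_sum {T} N (f : T -> Mat -> C) l :
  (forall x, In x l -> entry_polynomial N (f x)) ->
  entry_polynomial N (fun V => \sum_(x in l) f x V).
Proof.
  intros H; induction l as [|x l IH]; simpl; [apply entry_polynomial_const|].
  apply entry_polynomial_add; [apply H; left; reflexivity|].
  apply IH; intros y Hy; apply H; right; exact Hy.
Qed.

Lemma entry_polynomial_proper N f : entry_polynomial N f -> Proper (meq N ==> eq) f.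
Proof.
  induction 1 as [c|i j Hi Hj|f g _ IHf _ IHg|f g _ IHf _ IHg]; intros V W HVW.
  - reflexivity.
  - apply HVW; assumption.
  - rewrite (IHf V W HVW), (IHg V W HVW); reflexivity.
  - rewrite (IHf V W HVW), (IHg V W HVW); reflexivity.
Qed.

Section InvariantDerivative.
Variables (N : nat) (X : Mat).

Definition flow (V : Mat) (s : R) : Mat := V *[N] expm N (RtoC s *: X)%M.

Lemma flow_0 V : flow V 0 =[N] V.
Proof. unfold flow; rewrite expm_0; apply mmul_mid_r. Qed.

Lemma flow_derive V i j : (j < N)%nat -> is_Cderive (fun s => flow V s i j) 0 ((V *[N] X) i j).
Proof.
  intros Hj; apply is_Cderive_sum; intros k Hk; apply in_seq in Hk.
  apply is_Cderive_mul_l, expm_derive; lia.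
Qed.

Lemma Xtilde_eq f V l : is_Cderive (fun s => f (flow V s)) 0 l -> Xtilde N X f V = l.
Proof. intros [H1 H2]; apply C_ext; apply rderiv_eq; assumption. Qed.

Lemma entry_polynomial_derivable f V :
  entry_polynomial N f -> exists l, is_Cderive (fun s => f (flow V s)) 0 l.
Proof.
  induction 1 as [c|i j Hi Hj|f g _ [l Hl] _ [m Hm]|f g _ [l Hl] _ [m Hm]].
  - exists C0; apply is_Cderive_const.
  - eexists; apply flow_derive, Hj.
  - eexists; apply is_Cderive_add; eassumption.
  - eexists; apply is_Cderive_mul; eassumption.
Qed.

Lemma Xtilde_derive f V :
  entry_polynomial N f -> is_Cderive (fun s => f (flow V s)) 0 (Xtilde N X f V).
Proof.
  intros Hf; destruct (entry_polynomial_derivable f V Hf) as [l Hl].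
  rewrite (Xtilde_eq f V l Hl); exact Hl.
Qed.

Lemma Xtilde_const c V : Xtilde N X (fun _ => c) V = C0.
Proof. apply Xtilde_eq, is_Cderive_const. Qed.

Lemma Xtilde_entry i j V : (j < N)%nat -> Xtilde N X (fun V => V i j) V = (V *[N] X) i j.
Proof. intros Hj; apply (Xtilde_eq (fun V => V i j)), flow_derive, Hj. Qed.

Lemma Xtilde_add f g V : entry_polynomial N f -> entry_polynomial N g ->
  Xtilde N X (fun V => f V + g V) V = Xtilde N X f V + Xtilde N X g V.
Proof.
  intros Hf Hg; apply (Xtilde_eq (fun V => f V + g V)).
  apply is_Cderive_add; apply Xtilde_derive; assumption.
Qed.

Lemma Xtilde_mul f g V : entry_polynomial N f -> entry_polynomial N g ->
  Xtilde N X (fun V => f V * g V) V = Xtilde N X f V * g V + f V * Xtilde N X g V.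
Proof.
  intros Hf Hg; apply (Xtilde_eq (fun V => f V * g V)).
  rewrite <- (entry_polynomial_proper N f Hf _ _ (flow_0 V)).
  rewrite <- (entry_polynomial_proper N g Hg _ _ (flow_0 V)).
  apply (is_Cderive_mul (fun s => f (flow V s)) (fun s => g (flow V s)));
    apply Xtilde_derive; assumption.
Qed.

Lemma Xtilde_mul_l c f V : entry_polynomial N f ->
  Xtilde N X (fun V => c * f V) V = c * Xtilde N X f V.
Proof.
  intros Hf; rewrite (Xtilde_mul (fun _ => c)), Xtilde_const
    by (apply entry_polynomial_const || exact Hf); ring.
Qed.

Lemma Xtilde_sum {T} (f : T -> Mat -> C) l V :
  (forall x, In x l -> entry_polynomial N (f x)) ->
  Xtilde N X (fun V => \sum_(x in l) f x V) V = \sum_(x in l) Xtilde N X (f x) V.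
Proof.
  intros Hf; apply (Xtilde_eq (fun V => \sum_(x in l) f x V)), is_Cderive_sum.
  intros x Hx; apply Xtilde_derive, Hf, Hx.
Qed.

Lemma entry_polynomial_Xtilde f : entry_polynomial N f -> entry_polynomial N (Xtilde N X f).
Proof.
  induction 1 as [c|i j Hi Hj|f g Hf IHf Hg IHg|f g Hf IHf Hg IHg].
  - rewrite (functional_extensionality _ _ (Xtilde_const c)); apply entry_polynomial_const.
  - rewrite (functional_extensionality _ _ (fun V => Xtilde_entry i j V Hj)).
    apply entry_polynomial_sum; intros k Hk; apply in_seq in Hk.
    apply entry_polynomial_mul; [apply entry_polynomial_entry; lia|apply entry_polynomial_const].
  - rewrite (functional_extensionality _ _ (fun V => Xtilde_add f g V Hf Hg)).
    apply entry_polynomial_add; assumption.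
  - rewrite (functional_extensionality _ _ (fun V => Xtilde_mul f g V Hf Hg)).
    apply entry_polynomial_add; apply entry_polynomial_mul; assumption.
Qed.

End InvariantDerivative.

(** * The Laplacian of matrix-valued functions *)

Local Open Scope mat_scope.

Section MatrixFunctions.
Variable N : nat.
Implicit Types F G : Mat -> Mat.

Definition polynomial_map F : Prop :=
  forall i j, (i < N)%nat -> (j < N)%nat -> entry_polynomial N (fun V => F V i j).

Lemma polynomial_map_const A : polynomial_map (fun _ => A).
Proof. intros i j _ _; apply entry_polynomial_const. Qed.

Lemma polynomial_map_id : polynomial_map (fun V => V).
Proof. intros i j Hi Hj; apply entry_polynomial_entry; assumption. Qed.

Lemma polynomial_map_mscale f F : entry_polynomial N f -> polynomial_map F ->
  polynomial_map (fun V => f V *: F V).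
Proof. intros Hf HF i j Hi Hj; apply entry_polynomial_mul; [exact Hf|apply HF; assumption]. Qed.

Lemma polynomial_map_mmul F G : polynomial_map F -> polynomial_map G ->
  polynomial_map (fun V => F V *[N] G V).
Proof.
  intros HF HG i j Hi Hj; apply entry_polynomial_sum; intros k Hk; apply in_seq in Hk.
  apply (entry_polynomial_mul N (fun V => F V i k) (fun V => G V k j)); [apply HF|apply HG]; lia.
Qed.

Lemma polynomial_map_msum {T} (F : T -> Mat -> Mat) l :
  (forall x, In x l -> polynomial_map (F x)) -> polynomial_map (fun V => msum (fun x => F x V) l).
Proof.
  intros HF i j Hi Hj; apply (entry_polynomial_sum N (fun x V => F x V i j)).
  intros x Hx; apply HF; assumption.
Qed.

Lemma polynomial_map_mpow k : polynomial_map (fun V => mpow N V k).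
Proof.
  induction k as [|k IH]; [apply (polynomial_map_const mid)|].
  apply (polynomial_map_mmul (fun V => V)); [apply polynomial_map_id|exact IH].
Qed.

Lemma entry_polynomial_ntr F : polynomial_map F -> entry_polynomial N (fun V => ntr N (F V)).
Proof.
  intros HF; apply entry_polynomial_mul; [apply entry_polynomial_const|].
  apply (entry_polynomial_sum N (fun i V => F V i i)); intros i Hi; apply in_seq in Hi.
  apply HF; lia.
Qed.

Definition mXtilde (X : Mat) F : Mat -> Mat :=
  fun V i j => Xtilde N X (fun W => F W i j) V.

Lemma polynomial_map_mXtilde X F : polynomial_map F -> polynomial_map (mXtilde X F).
Proof. intros HF i j Hi Hj; apply entry_polynomial_Xtilde, HF; assumption. Qed.

Section MatrixDerivative.
Variable X : Mat.

Lemma mXtilde_ext F G V : (forall W, F W =[N] G W) -> mXtilde X F V =[N] mXtilde X G V.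
Proof.
  intros H i j Hi Hj; unfold mXtilde; f_equal; apply functional_extensionality.
  intros W; apply H; assumption.
Qed.

Lemma mXtilde_id V : mXtilde X (fun V => V) V =[N] V *[N] X.
Proof. intros i j _ Hj; apply Xtilde_entry, Hj. Qed.

Lemma mXtilde_madd F G V : polynomial_map F -> polynomial_map G ->
  mXtilde X (fun V => F V + G V) V =[N] mXtilde X F V + mXtilde X G V.
Proof.
  intros HF HG i j Hi Hj; apply (Xtilde_add N X (fun V => F V i j) (fun V => G V i j));
    [apply HF|apply HG]; assumption.
Qed.

Lemma mXtilde_mscale c F V : polynomial_map F ->
  mXtilde X (fun V => c *: F V) V =[N] c *: mXtilde X F V.
Proof.
  intros HF i j Hi Hj; apply (Xtilde_mul_l N X c (fun V => F V i j)), HF; assumption.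
Qed.

Lemma mXtilde_mmul F G V : polynomial_map F -> polynomial_map G ->
  mXtilde X (fun V => F V *[N] G V) V =[N] mXtilde X F V *[N] G V + F V *[N] mXtilde X G V.
Proof.
  intros HF HG i j Hi Hj; unfold mXtilde, madd, mmul; rewrite <- Csum_add.
  rewrite (Xtilde_sum N X (fun k V => (F V i k * G V k j)%c)).
  - apply Csum_ext_lt; intros k Hk.
    apply (Xtilde_mul N X (fun V => F V i k) (fun V => G V k j)); [apply HF|apply HG]; assumption.
  - intros k Hk; apply in_seq in Hk.
    apply (entry_polynomial_mul N (fun V => F V i k) (fun V => G V k j)); [apply HF|apply HG]; lia.
Qed.

Lemma mXtilde_mmul_const F A V : polynomial_map F ->
  mXtilde X (fun V => F V *[N] A) V =[N] mXtilde X F V *[N] A.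
Proof.
  intros HF; rewrite (mXtilde_mmul F (fun _ => A)) by (exact HF || apply polynomial_map_const).
  intros i j _ _; unfold madd, mmul at 2, mXtilde at 2.
  rewrite (Csum_eq0 (fun k => (F V i k * _)%c)); [ring|].
  intros k _; rewrite Xtilde_const; ring.
Qed.

Lemma mXtilde_ntr F V : polynomial_map F ->
  mXtilde X (fun V => ntr N (F V) *: mid) V =[N] ntr N (mXtilde X F V) *: mid.
Proof.
  intros HF i j _ _; unfold mXtilde at 1, mscale.
  rewrite (Xtilde_mul N X (fun V => ntr N (F V)) (fun _ => mid i j)), Xtilde_const
    by (apply entry_polynomial_const || apply entry_polynomial_ntr, HF).
  assert (Hdiag : forall k, In k (seq 0 N) -> entry_polynomial N (fun V => F V k k))
    by (intros k Hk; apply in_seq in Hk; apply HF; lia).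
  unfold ntr, mtrace.
  rewrite (Xtilde_mul_l N X _ (fun V => \sum_(k < N) F V k k)%c),
    (Xtilde_sum N X (fun k V => F V k k))
    by (try apply (entry_polynomial_sum N (fun k V => F V k k)); exact Hdiag).
  unfold mXtilde; ring.
Qed.

Lemma mXtilde_mpow k V :
  mXtilde X (fun V => mpow N V k) V =[N]
  msum (fun m => mpow N V (k - m) *[N] X *[N] mpow N V m) (seq 0 k).
Proof.
  induction k as [|k IH].
  - intros i j _ _; apply (Xtilde_const N X (mid i j)).
  - rewrite msum_seq_S, (msum_ext N _ (fun m =>
      V *[N] (mpow N V (k - m) *[N] X *[N] mpow N V m))).
    + replace (S k - k)%nat with 1%nat by lia; rewrite mpow_1, <- mmul_msum_l, <- IH.
      cbn [mpow]; rewrite (mXtilde_mmul (fun V => V)), mXtilde_id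
        by (apply polynomial_map_id || apply polynomial_map_mpow).
      intros i j _ _; unfold madd; ring.
    + intros m Hm; apply in_seq in Hm; rewrite Nat.sub_succ_l by lia.
      simpl; rewrite <- !mmul_assoc; reflexivity.
Qed.

Lemma ntr_mXtilde_mpow k V :
  ntr N (mXtilde X (fun V => mpow N V k) V) = (RtoC (INR k) * ntr N (X *[N] mpow N V k))%c.
Proof.
  rewrite mXtilde_mpow, ntr_msum.
  rewrite (Csum_ext_lt _ (fun _ => ntr N (X *[N] mpow N V k))).
  - rewrite Csum_const, length_seq; reflexivity.
  - intros m Hm; rewrite <- mmul_assoc, ntr_mmul_comm, <- mmul_assoc, mpow_add.
    replace (m + (k - m))%nat with k by lia; reflexivity.
Qed.

Lemma mXtilde_vtr k V :
  mXtilde X (fun V => vtr N V k *: mid) V =[N]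
  RtoC (INR k) * ntr N (X *[N] mpow N V k) *: mid.
Proof.
  unfold vtr; rewrite mXtilde_ntr by apply polynomial_map_mpow.
  rewrite ntr_mXtilde_mpow; reflexivity.
Qed.

End MatrixDerivative.

Section ProductRules.
Variable B : list Mat.

Definition carre_du_champ F G : Mat -> Mat :=
  fun U => msum (fun X => mXtilde X F U *[N] mXtilde X G U) B.

Lemma Laplacian_msum F U :
  Laplacian N B F U = msum (fun X => mXtilde X (mXtilde X F) U) B.
Proof. reflexivity. Qed.

Lemma Laplacian_ext F G U : (forall V, F V =[N] G V) -> Laplacian N B F U =[N] Laplacian N B G U.
Proof.
  intros H; apply msum_ext; intros X _; apply mXtilde_ext; intros V; apply mXtilde_ext, H.
Qed.

Lemma carre_du_champ_ext F F' G G' U : (forall V, F V =[N] F' V) -> (forall V, G V =[N] G' V) ->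
  carre_du_champ F G U =[N] carre_du_champ F' G' U.
Proof.
  intros HF HG; apply msum_ext; intros X _.
  rewrite (mXtilde_ext X F F' U HF), (mXtilde_ext X G G' U HG); reflexivity.
Qed.

Lemma Laplacian_const A U : Laplacian N B (fun _ => A) U =[N] mzero.
Proof.
  intros i j _ _; apply Csum_eq0; intros X _.
  rewrite (functional_extensionality _ _ (Xtilde_const N X (A i j))); apply Xtilde_const.
Qed.

Lemma Laplacian_madd F G U : polynomial_map F -> polynomial_map G ->
  Laplacian N B (fun V => F V + G V) U =[N] Laplacian N B F U + Laplacian N B G U.
Proof.
  intros HF HG; rewrite !Laplacian_msum, <- msum_madd; apply msum_ext; intros X _.
  rewrite (mXtilde_ext X _ _ U (fun V => mXtilde_madd X F G V HF HG)).
  apply mXtilde_madd; apply polynomial_map_mXtilde; assumption.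
Qed.

Lemma Laplacian_mscale c F U : polynomial_map F ->
  Laplacian N B (fun V => c *: F V) U =[N] c *: Laplacian N B F U.
Proof.
  intros HF; rewrite !Laplacian_msum, mscale_msum; apply msum_ext; intros X _.
  rewrite (mXtilde_ext X _ _ U (fun V => mXtilde_mscale X c F V HF)).
  apply mXtilde_mscale, polynomial_map_mXtilde, HF.
Qed.

Lemma Laplacian_mmul F G U : polynomial_map F -> polynomial_map G ->
  Laplacian N B (fun V => F V *[N] G V) U =[N]
  Laplacian N B F U *[N] G U + RtoC 2 *: carre_du_champ F G U + F U *[N] Laplacian N B G U.
Proof.
  intros HF HG; unfold carre_du_champ; rewrite !Laplacian_msum.
  rewrite mmul_msum_r, mmul_msum_l, mscale_msum, <- !msum_madd.
  apply msum_ext; intros X _.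
  pose proof (polynomial_map_mXtilde X F HF) as HXF.
  pose proof (polynomial_map_mXtilde X G HG) as HXG.
  rewrite (mXtilde_ext X _ _ U (fun V => mXtilde_mmul X F G V HF HG)).
  rewrite mXtilde_madd, !mXtilde_mmul by (try apply polynomial_map_mmul; assumption).
  intros i j _ _; unfold madd, mscale; apply C_ext; simpl; ring.
Qed.

Lemma Laplacian_ntr F U : polynomial_map F ->
  Laplacian N B (fun V => ntr N (F V) *: mid) U =[N] ntr N (Laplacian N B F U) *: mid.
Proof.
  intros HF; rewrite !Laplacian_msum, ntr_msum.
  transitivity (msum (fun X => ntr N (mXtilde X (mXtilde X F) U) *: mid) B);
    [|intros i j _ _; apply Csum_mul_r].
  apply msum_ext; intros X _.
  rewrite (mXtilde_ext X _ _ U (fun V => mXtilde_ntr X F V HF)).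
  apply mXtilde_ntr, polynomial_map_mXtilde, HF.
Qed.

Lemma carre_du_champ_ntr F G U : polynomial_map F -> polynomial_map G ->
  carre_du_champ (fun V => ntr N (F V) *: mid) (fun V => ntr N (G V) *: mid) U =[N]
  ntr N (carre_du_champ (fun V => ntr N (F V) *: mid) G U) *: mid.
Proof.
  intros HF HG; unfold carre_du_champ; rewrite ntr_msum.
  transitivity (msum (fun X => ntr N (mXtilde X (fun V => ntr N (F V) *: mid) U
    *[N] mXtilde X G U) *: mid) B); [|intros i j _ _; apply Csum_mul_r].
  apply msum_ext; intros X _; rewrite !mXtilde_ntr by assumption.
  rewrite !mmul_mscale_l, !mmul_mid_l, ntr_mscale, mscale_mscale; reflexivity.
Qed.

Lemma carre_du_champ_mmul F g G U : entry_polynomial N g -> polynomial_map G ->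
  carre_du_champ F (fun V => (g V *: mid) *[N] G V) U =[N]
  carre_du_champ F (fun V => g V *: mid) U *[N] G U + g U *: carre_du_champ F G U.
Proof.
  intros Hg HG; unfold carre_du_champ; rewrite mmul_msum_r, mscale_msum, <- msum_madd.
  apply msum_ext; intros X _.
  rewrite (mXtilde_mmul X (fun V => g V *: mid))
    by (try apply polynomial_map_mscale; try apply polynomial_map_const; assumption).
  rewrite mmul_madd_r, mmul_assoc, (mmul_mscale_l _ (g U)), mmul_mid_l, mmul_mscale_r.
  reflexivity.
Qed.

End ProductRules.

End MatrixFunctions.

Section PowersAndTraces.
Variables (N : nat) (B : list Mat).
Hypotheses (HN : (1 <= N)%nat) (HB : onb_uN N B).

Lemma Laplacian_id U : Laplacian N B (fun V => V) U =[N] - C1 *: U.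
Proof.
  rewrite Laplacian_msum.
  transitivity (U *[N] msum (fun X => X *[N] mid *[N] X) B).
  - rewrite mmul_msum_l; apply msum_ext; intros X _.
    rewrite (mXtilde_ext N X _ _ U (mXtilde_id N X)).
    rewrite mXtilde_mmul_const, mXtilde_id, mmul_mid_r, mmul_assoc by apply polynomial_map_id.
    reflexivity.
  - rewrite onb_sum_sandwich, ntr_mid, mmul_mscale_r, mmul_mid_r by assumption; reflexivity.
Qed.

Lemma carre_du_champ_id_mpow k U :
  carre_du_champ N B (fun V => V) (fun V => mpow N V k) U =[N]
  - C1 *: msum (fun m => vtr N U (k - m) *: mpow N U (S m)) (seq 0 k).
Proof.
  unfold carre_du_champ.
  transitivity (msum (fun X => msum (fun m =>
    U *[N] (X *[N] mpow N U (k - m) *[N] X) *[N] mpow N U m) (seq 0 k)) B).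
  - apply msum_ext; intros X _; rewrite mXtilde_id, mXtilde_mpow, mmul_msum_l.
    apply msum_ext; intros m _; rewrite !mmul_assoc; reflexivity.
  - rewrite msum_exchange, mscale_msum; apply msum_ext; intros m _.
    rewrite <- mmul_msum_r, <- mmul_msum_l, onb_sum_sandwich by assumption.
    rewrite mmul_mscale_r, mmul_mid_r, mmul_mscale_l, mscale_mscale.
    intros i j _ _; unfold mscale, vtr; simpl mpow; ring.
Qed.

Lemma msum_mul_seq_S k U :
  msum (fun m => RtoC (INR m) * vtr N U (S k - m) *: mpow N U m) (seq 0 (S k)) =[N]
  msum (fun m => vtr N U (k - m) *: mpow N U (S m)) (seq 0 k) +
  U *[N] msum (fun m => RtoC (INR m) * vtr N U (k - m) *: mpow N U m) (seq 0 k).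
Proof.
  rewrite msum_seq_S_l, mmul_msum_l, <- msum_madd.
  rewrite (msum_ext N (fun m => _ + _)
    (fun m => RtoC (INR (S m)) * vtr N U (S k - S m) *: mpow N U (S m))).
  - intros i j _ _; unfold madd, mscale; change (RtoC (INR 0)) with C0; ring.
  - intros m _; rewrite mmul_mscale_r, RtoC_S, Nat.sub_succ.
    intros i j _ _; unfold madd, mscale; cbn [mpow]; ring.
Qed.

Lemma Laplacian_mpow k U :
  Laplacian N B (fun V => mpow N V k) U =[N]
  RtoC (- INR k) *: mpow N U k +
  RtoC (-2) *: msum (fun m => RtoC (INR m) * vtr N U (k - m) *: mpow N U m) (seq 0 k).
Proof.
  induction k as [|k IH].
  - rewrite (Laplacian_const N B mid); intros i j _ _; apply C_ext; simpl; ring.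
  - simpl mpow.
    rewrite (Laplacian_mmul N B (fun V => V))
      by (apply polynomial_map_id || apply polynomial_map_mpow).
    rewrite Laplacian_id, carre_du_champ_id_mpow, IH, msum_mul_seq_S.
    rewrite mmul_mscale_l, mmul_madd_r, !mmul_mscale_r, !RtoC_opp, RtoC_S.
    intros i j _ _; unfold madd, mscale; apply C_ext; simpl; ring.
Qed.

Lemma carre_du_champ_vtr_mpow j k U :
  carre_du_champ N B (fun V => vtr N V j *: mid) (fun V => mpow N V k) U =[N]
  RtoC (- / (INR N * INR N)) * RtoC (INR j * INR k) *: mpow N U (j + k).
Proof.
  unfold carre_du_champ.
  transitivity (RtoC (INR j) *: msum (fun m => mpow N U (k - m) *[N]
    msum (fun X => ntr N (X *[N] mpow N U j) *: X) B *[N] mpow N U m) (seq 0 k)).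
  - rewrite mscale_msum.
    transitivity (msum (fun m => msum (fun X => RtoC (INR j) * ntr N (X *[N] mpow N U j) *:
      (mpow N U (k - m) *[N] X *[N] mpow N U m)) B) (seq 0 k)).
    + rewrite msum_exchange; apply msum_ext; intros X _.
      rewrite mXtilde_vtr, mXtilde_mpow, mmul_mscale_l, mmul_mid_l, mscale_msum; reflexivity.
    + apply msum_ext; intros m _; rewrite mmul_msum_l, mmul_msum_r, mscale_msum.
      apply msum_ext; intros X _.
      rewrite mmul_mscale_r, mmul_mscale_l, mscale_mscale; reflexivity.
  - rewrite (msum_ext N _ (fun _ => RtoC (- / (INR N * INR N)) *: mpow N U (j + k))).
    + rewrite msum_const, length_seq, RtoC_mul.
      intros a b _ _; unfold mscale; ring.
    + intros m Hm; apply in_seq in Hm.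
      rewrite onb_sum_trace, mmul_mscale_r, mmul_mscale_l, !mpow_add by assumption.
      replace (k - m + j + m)%nat with (j + k)%nat by lia; reflexivity.
Qed.

Lemma carre_du_champ_vtr_vtr j k U :
  carre_du_champ N B (fun V => vtr N V j *: mid) (fun V => vtr N V k *: mid) U =[N]
  RtoC (- / (INR N * INR N)) * RtoC (INR j * INR k) *: (vtr N U (j + k) *: mid).
Proof.
  transitivity (ntr N (carre_du_champ N B (fun V => vtr N V j *: mid)
    (fun V => mpow N V k) U) *: mid).
  - apply (carre_du_champ_ntr N B (fun V => mpow N V j) (fun V => mpow N V k));
      apply polynomial_map_mpow.
  - rewrite carre_du_champ_vtr_mpow, ntr_mscale, mscale_mscale by assumption; reflexivity.
Qed.

End PowersAndTraces.

(** * Evaluation of polynomials at a matrix *)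

Local Close Scope mat_scope.

Definition Cprod (l : list C) : C := fold_right Cmul C1 l.

Lemma Cprod_app l l' : Cprod (l ++ l') = Cprod l * Cprod l'.
Proof. induction l as [|c l IH]; simpl; [|rewrite IH]; ring. Qed.

Lemma Cprod_repeat c n : Cprod (repeat c n) = Cpow c n.
Proof. induction n as [|n IH]; simpl; [|rewrite IH]; reflexivity. Qed.

Lemma Cprod_perm l l' : Permutation l l' -> Cprod l = Cprod l'.
Proof.
  induction 1 as [|c l l' _ IH|c d l|l l' l'' _ IH _ IH']; simpl;
    [reflexivity|rewrite IH; reflexivity|ring|congruence].
Qed.

Lemma Cprod_gens_from (t : nat -> C) s l :
  Cprod (map (fun j => Cpow (t j) (nth (j - s) l 0%nat)) (seq s (length l))) =
  Cprod (map t (gens_from s l)).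
Proof.
  revert s; induction l as [|x l IH]; intros s; simpl; [reflexivity|].
  rewrite map_app, map_repeat, Cprod_app, Cprod_repeat, <- IH, Nat.sub_diag; f_equal; f_equal.
  apply map_ext_in; intros j Hj; apply in_seq in Hj.
  replace (j - s)%nat with (S (j - S s)) by lia; reflexivity.
Qed.

Section Evaluation.
Variables (N : nat) (U : Mat).

Lemma tprod_gens e : tprod N U e = Cprod (map (vtr N U) (gens e)).
Proof.
  destruct e as [|x l]; [reflexivity|].
  unfold gens; cbn [tl]; rewrite <- Cprod_gens_from; unfold tprod, Cprod; f_equal.
  cbn [length]; rewrite Nat.sub_succ, Nat.sub_0_r.
  apply map_ext_in; intros j Hj; apply in_seq in Hj.
  destruct j as [|j]; [lia|]; rewrite Nat.sub_succ, Nat.sub_0_r; reflexivity.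
Qed.

Lemma tprod_eadd a b : tprod N U (eadd a b) = tprod N U a * tprod N U b.
Proof.
  rewrite !tprod_gens, <- Cprod_app, <- map_app.
  apply Cprod_perm, Permutation_map, gens_eadd.
Qed.

Lemma peval_linext p i j :
  peval N p U i j = linext (fun e => tprod N U e * mpow N U (nth 0 e 0%nat) i j) p.
Proof. apply Csum_ext; intros; ring. Qed.

Lemma peval_peq p q : peq p q -> peval N p U =[N] peval N q U.
Proof.
  intros H i j _ _; rewrite !peval_linext; apply peq_linext; [exact H|].
  intros a b Hab; rewrite !tprod_gens, (strip_invariant_gens a b Hab),
    (strip_invariant_nth 0 a b Hab); reflexivity.
Qed.

Lemma peval_padd p q : peval N (p + q)%P U =[N] (peval N p U + peval N q U)%M.
Proof. intros i j _ _; unfold madd; rewrite !peval_linext; apply linext_padd. Qed.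

Lemma peval_pscale c p : peval N (c *: p)%P U =[N] (c *: peval N p U)%M.
Proof. intros i j _ _; unfold mscale; rewrite !peval_linext; apply linext_pscale. Qed.

Lemma peval_psum {T} (f : T -> cpoly) l :
  peval N (psum (map f l)) U =[N] msum (fun x => peval N (f x) U) l.
Proof.
  induction l as [|x l IH]; [reflexivity|].
  change (peval N (f x + psum (map f l))%P U =[N]
    (peval N (f x) U + msum (fun x => peval N (f x) U) l)%M).
  rewrite peval_padd, IH; reflexivity.
Qed.

Lemma peval_pmul p q : peval N (p * q)%P U =[N] peval N p U *[N] peval N q U.
Proof.
  set (term_value := fun t : term =>
    ((fst t * tprod N U (snd t)) *: mpow N U (nth 0 (snd t) 0%nat))%M).
  assert (Hterm : forall t t', term_value t *[N] term_value t' =[N]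
    term_value (fst t * fst t', eadd (snd t) (snd t'))).
  { intros t t'; unfold term_value; cbn [fst snd].
    rewrite mmul_mscale_l, mmul_mscale_r, mscale_mscale, mpow_add, tprod_eadd, nth_eadd.
    intros i j _ _; unfold mscale; ring. }
  change (peval N p U) with (msum term_value p); change (peval N q U) with (msum term_value q).
  rewrite mmul_msum_r.
  rewrite (msum_ext N _ (fun t => msum (fun t' => term_value t *[N] term_value t') q))
    by (intros; apply mmul_msum_l).
  intros i j Hi Hj; unfold peval, pmul; rewrite Csum_flat_map.
  apply Csum_ext; intros t _; rewrite map_map; apply Csum_ext; intros t' _.
  symmetry; apply (Hterm t t'); assumption.
Qed.

Lemma peval_pu k : peval N (pu k) U =[N] mpow N U k.
Proof.
  intros i j _ _; rewrite peval_linext; unfold pu; rewrite linext_term, tprod_gens; simpl; ring.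
Qed.

Lemma peval_pv k : (1 <= k)%nat -> peval N (pv k) U =[N] (vtr N U k *: mid)%M.
Proof.
  intros Hk i j _ _; rewrite peval_linext; unfold pv, mscale.
  rewrite linext_term, tprod_gens, gens_pv, nth_repeat_1 by exact Hk.
  destruct k as [|k]; [lia|]; simpl; ring.
Qed.

Lemma peval_pmul_pv k p : (1 <= k)%nat ->
  peval N (pv k * p)%P U =[N] (vtr N U k *: peval N p U)%M.
Proof.
  intros Hk; rewrite peval_pmul, peval_pv, mmul_mscale_l, mmul_mid_l by exact Hk; reflexivity.
Qed.

Lemma peval_Du k :
  peval N (Du k) U =[N]
  (RtoC (- INR k) *: mpow N U k +
   RtoC (-2) *: msum (fun m => RtoC (INR m) * vtr N U (k - m) *: mpow N U m) (seq 0 k))%M.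
Proof.
  unfold Du; rewrite peval_padd, !peval_pscale, peval_pu, peval_psum.
  apply madd_proper, mscale_proper; [reflexivity|reflexivity|].
  transitivity (msum (fun m => RtoC (INR m) * vtr N U (k - m) *: mpow N U m)%M (seq 1 (k - 1))).
  - apply msum_ext; intros m Hm; apply in_seq in Hm; rewrite peval_pscale.
    rewrite (peval_peq _ (pv (k - m) * pu m)%P) by ring.
    rewrite peval_pmul_pv, peval_pu, mscale_mscale by lia; reflexivity.
  - intros i j _ _; apply (Csum_seq_from_1 (fun m =>
      RtoC (INR m) * vtr N U (k - m) * mpow N U m i j)); change (RtoC (INR 0)) with C0; ring.
Qed.

Lemma peval_Dv k : (1 <= k)%nat -> peval N (Dv k) U =[N] (ntr N (peval N (Du k) U) *: mid)%M.
Proof.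
  intros Hk; unfold Dv, Du; rewrite !peval_padd, !peval_pscale, !peval_psum, peval_pu, peval_pv
    by exact Hk.
  rewrite ntr_madd, !ntr_mscale, ntr_msum; fold (vtr N U k).
  transitivity (RtoC (- INR k) *: (vtr N U k *: mid) + RtoC (-2) *:
    msum (fun m => ntr N (peval N (RtoC (INR m) *: (pu m * pv (k - m)))%P U) *: mid)
      (seq 1 (k - 1)))%M.
  - apply madd_proper, mscale_proper; [reflexivity|reflexivity|].
    apply msum_ext; intros m Hm; apply in_seq in Hm; rewrite !peval_pscale, ntr_mscale.
    rewrite !peval_pmul, peval_pu, !peval_pv by lia.
    rewrite mmul_mscale_l, !mmul_mscale_r, mmul_mid_l, mmul_mid_r, ntr_mscale, !mscale_mscale.
    fold (vtr N U m); intros i j _ _; unfold mscale; ring.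
  - intros i j _ _; unfold madd, mscale, msum; rewrite Csum_mul_r; ring.
Qed.

End Evaluation.

Lemma polynomial_map_peval N p : polynomial_map N (peval N p).
Proof.
  assert (Htprod : forall e, entry_polynomial N (fun V => tprod N V e)).
  { intros e; rewrite (functional_extensionality _ _ (fun V => tprod_gens N V e)).
    induction (gens e) as [|j l IH]; simpl; [apply entry_polynomial_const|].
    apply (entry_polynomial_mul N (fun V => vtr N V j)); [|exact IH].
    apply entry_polynomial_ntr, polynomial_map_mpow. }
  apply (polynomial_map_msum N (fun (t : term) V =>
    ((fst t * tprod N V (snd t)) *: mpow N V (nth 0 (snd t) 0%nat))%M)); intros t _.
  apply polynomial_map_mscale; [|apply polynomial_map_mpow].
  apply entry_polynomial_mul; [apply entry_polynomial_const|apply Htprod].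
Qed.

Section LaplacianFormula.
Local Open Scope mat_scope.
Variables (N : nat) (B : list Mat).
Hypotheses (HN : (1 <= N)%nat) (HB : onb_uN N B).

Lemma Laplacian_pu k U : Laplacian N B (peval N (pu k)) U =[N] peval N (Du k) U.
Proof.
  rewrite peval_Du, <- (Laplacian_mpow N B HN HB).
  apply Laplacian_ext; intros V; apply peval_pu.
Qed.

Lemma Laplacian_pv k U : (1 <= k)%nat ->
  Laplacian N B (peval N (pv k)) U =[N] peval N (Dv k) U.
Proof.
  intros Hk; rewrite (Laplacian_ext N B _ _ U (fun V => peval_pv N V k Hk)); unfold vtr.
  rewrite Laplacian_ntr, Laplacian_mpow, <- peval_Du, peval_Dv
    by (assumption || apply polynomial_map_mpow); reflexivity.
Qed.

Lemma carre_du_champ_mono j k l U : (1 <= j)%nat -> Forall (le 1) l ->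
  carre_du_champ N B (peval N (pv j)) (peval N (mono k l)) U =[N]
  RtoC (- / (INR N * INR N)) *: peval N (cross j k l) U.
Proof.
  intros Hj; induction 1 as [|i l Hi Hl IH].
  - rewrite (carre_du_champ_ext N B _ (fun V => vtr N V j *: mid) _ (fun V => mpow N V k)).
    + rewrite carre_du_champ_vtr_mpow, (peval_peq N U _ _ (cross_nil j k)) by assumption.
      rewrite peval_pscale, peval_pu, mscale_mscale; reflexivity.
    + intros V; apply peval_pv, Hj.
    + intros V; rewrite <- peval_pu; apply peval_peq, mono_nil.
  - rewrite (carre_du_champ_ext N B _ (peval N (pv j)) _
      (fun V => (vtr N V i *: mid) *[N] peval N (mono k l) V)).
    + rewrite carre_du_champ_mmul, IH
        by (apply entry_polynomial_ntr, polynomial_map_mpow || apply polynomial_map_peval).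
      rewrite (carre_du_champ_ext N B _ (fun V => vtr N V j *: mid) _
        (fun V => vtr N V i *: mid)) by (intros V; try apply peval_pv; easy).
      rewrite carre_du_champ_vtr_vtr, (peval_peq N U _ _ (cross_cons j k i l))
        by assumption.
      rewrite peval_padd, !peval_pmul, peval_pscale, !peval_pv by lia.
      rewrite !mmul_mscale_l, !mmul_mid_l.
      intros a b _ _; unfold madd, mscale; ring.
    + reflexivity.
    + intros V; rewrite (peval_peq N V _ _ (mono_cons k i l)).
      rewrite peval_pmul, peval_pv by exact Hi; reflexivity.
Qed.

Lemma Laplacian_mono k l U : Forall (le 1) l ->
  Laplacian N B (peval N (mono k l)) U =[N]
  peval N (Dmono k l) U + RtoC (- / (INR N * INR N)) *: peval N (Lmono k l) U.
Proof.
  induction 1 as [|j l Hj Hl IH].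
  - rewrite (peval_peq N U _ _ (Dmono_nil k)), <- Laplacian_pu.
    rewrite (Laplacian_ext N B _ (peval N (pu k)))
      by (intros V; apply peval_peq, mono_nil).
    intros i a _ _; unfold madd, mscale; change (peval N (Lmono k []) U i a) with C0; ring.
  - rewrite (Laplacian_ext N B _ (fun V => peval N (pv j) V *[N] peval N (mono k l) V))
      by (intros V; rewrite <- peval_pmul; apply peval_peq, mono_cons).
    rewrite Laplacian_mmul, Laplacian_pv, carre_du_champ_mono, IH
      by (assumption || apply polynomial_map_peval).
    rewrite (peval_peq N U _ _ (Dmono_cons k j l)); simpl.
    rewrite !peval_padd, peval_pscale, !peval_pmul, !mmul_madd_r, mmul_mscale_r.
    intros i a _ _; unfold madd, mscale; ring.
Qed.

Lemma Laplacian_peval p U : Laplacian N B (peval N p) U =[N] peval N (DN N opD opL p) U.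
Proof.
  unfold DN; rewrite peval_padd, peval_pscale.
  induction p as [|[c e] p IH].
  - rewrite (Laplacian_const N B mzero).
    intros i j _ _; unfold madd, mscale, mzero, peval; simpl; ring.
  - change (opD ((c, e) :: p)) with (c *: Dmono (nth 0 e 0%nat) (gens e) + opD p)%P.
    change (opL ((c, e) :: p)) with (c *: Lmono (nth 0 e 0%nat) (gens e) + opL p)%P.
    rewrite (Laplacian_ext N B _
      (fun V => c *: peval N (mono (nth 0 e 0%nat) (gens e)) V + peval N p V)).
    + rewrite Laplacian_madd, Laplacian_mscale, Laplacian_mono, IH
        by (try apply polynomial_map_mscale; try apply entry_polynomial_const;
            try apply polynomial_map_peval; apply gens_pos).
      rewrite !peval_padd, !peval_pscale.
      intros i j _ _; unfold madd, mscale; ring.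
    + intros V; rewrite (peval_peq N V _ _ (peq_cons c e p)), peval_padd, peval_pscale.
      rewrite (peval_peq N V _ _ (single_mono e)); reflexivity.
Qed.

End LaplacianFormula.

Theorem mainTheorem10 :
  exists D L : cpoly -> cpoly,
    plinear D /\ plinear L /\
    (forall (N : nat), (1 <= N)%nat ->
       forall (B : list Mat), onb_uN N B ->
       forall (p : cpoly) (U : Mat), unitary N U ->
       forall i j, (i < N)%nat -> (j < N)%nat ->
         Laplacian N B (peval N p) U i j = peval N (DN N D L p) U i j) /\
    D_props D /\
    (forall D' : cpoly -> cpoly, plinear D' -> D_props D' -> forall p, peq (D' p) (D p)).
Proof.
  exists opD, opL.
  split; [exact plinear_opD|]; split; [exact plinear_opL|].
  split; [|split; [exact opD_props|exact D_props_unique]].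
  intros N HN B HB p U _ i j Hi Hj; apply Laplacian_peval; assumption.
Qed.
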